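(* Let $\mathbb{K}$ be a field of characteristic zero and let $\mathcal{F}$ be the class of all freedom matroids. The algebra $\mathcal{A}(\mathcal{F})$ is the free (noncommutative, associative) algebra generated by the point $I$ and the loop $Z$; that is, the products $M_{x_1}\cdots M_{x_n}$, over all words $x_1\cdots x_n$ on $\{0,1\}$ (including the empty word, whose product is the unit), form a $\mathbb{K}$-basis of $\mathcal{A}(\mathcal{F})$, where $M_1=I$ and $M_0=Z$.
   Context: All matroids are finite. A flag on a finite set $S$ is a sequence $(S_0,\dots,S_r)$ of subsets of $S$ with $S_r=S$ and $S_{i-1}$ a proper subset of $S_i$ for $1\le i\le r$ ($S_0$ need not be empty). The freedom matroid $M(S_0,\dots,S_r)$ is the matroid on $S$ whose independent sets are the $I\subseteq S$ with $|I\cap S_i|\le i$ for all $i$. The class $\mathcal{F}$ of freedom matroids is closed under taking minors. For a word $w=x_1\cdots x_n$ on $\{0,1\}$ with $r$ ones, at positions $p_1<\dots<p_r$, and $S=\{e_1,\dots,e_n\}$, let $M_w$ be the freedom matroid $M(S_0,\dots,S_r)$ with $S_r=S$ and $S_{k-1}=\{e_1,\dots,e_{p_k-1}\}$ for $1\le k\le r$; every freedom matroid is isomorphic to exactly one $M_w$. The point $I$ is the one-element matroid of rank 1 and the loop $Z$ the one-element matroid of rank 0. For matroids $N_1,N_2$ and $M=M(S)$, the section coefficient $\binom{M}{N_1,N_2}$ is the number of subsets $A\subseteq S$ with $M|A\cong N_1$ and $M/A\cong N_2$ (restriction and contraction). For a minor-closed class $\mathcal{M}$, $\mathcal{A}(\mathcal{M})$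 is the free $\mathbb{K}$-module with basis the isomorphism classes of matroids in $\mathcal{M}$, with product $N_1\cdot N_2=\sum_{M}\binom{M}{N_1,N_2}M$, the sum over isomorphism classes $M$ in $\mathcal{M}$; it is an associative algebra with unit the empty matroid. *)

(* Defs.v *)
From HB Require Import structures.
From mathcomp Require Import all_boot all_order all_algebra.
From mathcomp Require Import finmap.
From mathcomp.multinomials Require Import monalg.
From mathcomp.classical Require Import boolp classical_sets cardinality fsbigop.

Set Implicit Arguments.
Unset Strict Implicit.
Unset Printing Implicit Defensive.

Local Open Scope fset_scope.
Local Open Scope nat_scope.

(* Matroids on finite sets of natural numbers, given by independent sets.     *)
(* Only isomorphism classes matter below, and every finite matroid is         *)
(* isomorphic to one labelled by natural numbers.                             *)
Definition is_matroid (S : {fset nat}) (D : {fset {fset nat}}) : Prop :=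
  [/\ forall I, I \in D -> I `<=` S,
      fset0 \in D,
      forall I J, J \in D -> I `<=` J -> I \in D &
      forall I J, I \in D -> J \in D -> #|` I| < #|` J| ->
        exists2 x, x \in J `\` I & x |` I \in D].

Record matroid := Matroid {
  ground : {fset nat};
  indep : {fset {fset nat}};
  matroidP : is_matroid ground indep
}.

HB.instance Definition _ := gen_eqMixin matroid.
HB.instance Definition _ := gen_choiceMixin matroid.

Lemma matroid_eq (M N : matroid) :
  ground M = ground N -> indep M =i indep N -> M = N.
Proof.
case: M N => [S D ax] [S' D' ax'] /= eS /fsetP eD.
by subst S' D'; congr Matroid; apply: Prop_irrelevance.
Qed.

Section MatroidTheory.
Variable M : matroid.
Implicit Types A B I J : {fset nat}.

Lemma indep_sub I : I \in indep M -> I `<=` ground M.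
Proof. by case: (matroidP M) => + _ _ _; apply. Qed.

Lemma indep0 : fset0 \in indep M.
Proof. by case: (matroidP M). Qed.

Lemma indepS I J : J \in indep M -> I `<=` J -> I \in indep M.
Proof. by case: (matroidP M) => _ _ + _; apply. Qed.

Lemma indep_aug I J : I \in indep M -> J \in indep M -> #|` I| < #|` J| ->
  exists2 x, x \in J `\` I & x |` I \in indep M.
Proof. by case: (matroidP M) => _ _ _; apply. Qed.

Lemma indep_extend I J : I \in indep M -> J \in indep M -> #|` I| <= #|` J| ->
  exists K, [/\ K \in indep M, I `<=` K, K `<=` I `|` J & #|` K| = #|` J|].
Proof.
move: {2}(#|` J| - #|` I|) (leqnn (#|` J| - #|` I|)) => n.
elim: n I => [|n IHn] I len iI iJ leIJ.
  exists I; split=> //; first exact: fsubsetUl.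
  by apply/eqP; rewrite eqn_leq leIJ -subn_eq0 -leqn0.
move: leIJ; rewrite leq_eqVlt => /orP[/eqP eIJ|ltIJ].
  by exists I; split=> //; exact: fsubsetUl.
have [x] := indep_aug iI iJ ltIJ; rewrite in_fsetD => /andP[xI xJ] ixI.
have cxI : #|` x |` I| = #|` I|.+1 by rewrite cardfsU1 xI.
have [||//|//|K [iK sK Ks cK]] := IHn (x |` I); rewrite ?cxI //.
  by rewrite subnS -subn1 leq_subLR add1n.
exists K; split=> //; first exact: fsubset_trans (fsubsetU1 x I) sK.
apply: fsubset_trans Ks _; apply/fsubsetP => y; rewrite !inE.
by case/orP=> [/orP[/eqP->|->]|->] //; rewrite ?xJ orbT.
Qed.

(* B is a basis of the restriction M | A. *)
Definition basis_of A B : Prop :=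
  [/\ B \in indep M, B `<=` A &
      forall B', B' \in indep M -> B `<=` B' -> B' `<=` A -> B' = B].

Lemma basis_extend A I : I \in indep M -> I `<=` A ->
  exists2 B, basis_of A B & I `<=` B.
Proof.
move: {2}(#|` ground M| - #|` I|) (leqnn (#|` ground M| - #|` I|)) => n.
elim: n I => [|n IHn] I len iI sIA;
    have [bI|nbI] := pselect (basis_of A I); try by exists I.
- case: nbI; split=> // B' iB' sB' _; apply/eqP; rewrite eq_sym.
  rewrite -(fsubset_leqif_cards sB') eqn_leq fsubset_leq_card //=.
  apply: leq_trans (fsubset_leq_card (indep_sub iB')) _.
  by rewrite -subn_eq0 -leqn0.
- have [J [iJ sIJ sJA neJ]] : exists J,
      [/\ J \in indep M, I `<=` J, J `<=` A & J != I].
    apply: contrapT => nJ; apply: nbI; split=> // B' iB' sB' sB'A.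
    apply: contrapT => /eqP ne; apply: nJ; by exists B'.
  have ltIJ : #|` I| < #|` J|.
    by rewrite ltn_neqAle (fsubset_leqif_cards sIJ) fsubset_leq_card // eq_sym neJ.
  have [|//|//|B bB sJB] := IHn J.
    rewrite -ltnS; apply: leq_trans len; apply: ltn_sub2l => //.
    exact: leq_trans ltIJ (fsubset_leq_card (indep_sub iJ)).
  by exists B => //; exact: fsubset_trans sJB.
Qed.

Lemma basis_exists A : exists B, basis_of A B.
Proof.
by have [B bB _] := basis_extend indep0 (fsub0set A); exists B.
Qed.

Lemma basis_max A B I : basis_of A B -> I \in indep M -> I `<=` A ->
  #|` I| <= #|` B|.
Proof.
move=> [iB sB mB] iI sI; rewrite leqNgt; apply/negP => ltBI.
have [x] := indep_aug iB iI ltBI; rewrite in_fsetD => /andP[xB xI] ixB.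
have eB : x |` B = B.
  apply: mB ixB (fsubsetU1 x B) _; apply/fsubsetP => y; rewrite !inE.
  by case/orP=> [/eqP->|]; [exact: (fsubsetP sI)|exact: (fsubsetP sB)].
by move: xB; rewrite -eB !inE eqxx.
Qed.

Lemma basis_card A B B' : basis_of A B -> basis_of A B' -> #|` B| = #|` B'|.
Proof.
move=> bB bB'; apply/eqP; rewrite eqn_leq.
by rewrite (basis_max bB') ?(basis_max bB) //; case: bB bB' => ? ? _ [].
Qed.

Definition restr_indep A := [fset I in indep M | I `<=` A].

Lemma restr_is_matroid A : is_matroid (ground M `&` A) (restr_indep A).
Proof.
split=> [I|||I J].
- by rewrite !inE /= fsubsetI => /andP[/indep_sub-> ->].
- by rewrite !inE /= indep0 fsub0set.
- move=> I J; rewrite !inE /= => /andP[iJ sJ] sIJ.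
  by rewrite (indepS iJ) // (fsubset_trans sIJ).
- rewrite !inE /= => /andP[iI sI] /andP[iJ sJ] ltIJ.
  have [x xJI ixI] := indep_aug iI iJ ltIJ; exists x => //.
  rewrite !inE /= ixI /=; apply/fsubsetP => y; rewrite !inE.
  case/orP=> [/eqP->|]; last exact: (fsubsetP sI).
  by apply: (fsubsetP sJ); move: xJI; rewrite !inE => /andP[].
Qed.

Definition restr A : matroid := Matroid (restr_is_matroid A).

(* Independence in M / A: the choice of the basis B of A is immaterial, by     *)
(* contr_indepE.                                                              *)
Definition contr_indep A :=
  [fset I in fpowerset (ground M `\` A) |
     `[< exists2 B, basis_of A B & I `|` B \in indep M >]].

Lemma contr_indepE A B I : basis_of A B ->
  (I \in contr_indep A) = (I `<=` ground M `\` A) && (I `|` B \in indep M).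
Proof.
move=> bB; rewrite !inE /= fpowersetE; case: fsubsetP => //= sI.
apply/asboolP/idP => [[B' bB' iIB']|]; last by exists B.
have [iB sBA mB] := bB; have [iB' sB'A _] := bB'.
have dis X : X `<=` A -> [disjoint I & X].
  move=> sX; apply/fdisjointP => x /sI; rewrite !inE => /andP[xA _].
  by apply: contra xA; exact: (fsubsetP sX).
have cU X : X `<=` A -> #|` I `|` X| = #|` I| + #|` X|.
  by move=> /dis; rewrite -fsetI_eq0 => /eqP dX; rewrite cardfsU dX cardfs0 subn0.
have [|K [iK sBK sK cK]] := indep_extend iB iIB'.
  by rewrite cU // (basis_card bB bB') leq_addl.
have KA : K `&` A = B.
  apply: mB; rewrite ?fsubsetIr //; first exact: indepS iK (fsubsetIl _ _).
  by rewrite fsubsetI sBK.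
have sKI : K `<=` I `|` B.
  apply/fsubsetP => x xK; have [xA|xA] := boolP (x \in A).
    by rewrite -KA !inE xK xA !orbT.
  move/fsubsetP: sK => /(_ x xK); rewrite !inE.
  case/orP=> [xB|/orP[->//|xB']]; first by rewrite xB orbT.
  by move/fsubsetP: sB'A => /(_ x xB'); rewrite (negPf xA).
suff <- : K = I `|` B by [].
apply/eqP; rewrite -(fsubset_leqif_cards sKI) cK !cU //.
by rewrite (basis_card bB bB').
Qed.

Lemma contr_is_matroid A : is_matroid (ground M `\` A) (contr_indep A).
Proof.
have [B bB] := basis_exists A; have [iB sBA _] := bB.
have cU X : X `<=` ground M `\` A -> #|` X `|` B| = #|` X| + #|` B|.
  move=> sX; suff /eqP dX : X `&` B == fset0 by rewrite cardfsU dX cardfs0 subn0.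
  rewrite fsetI_eq0; apply/fdisjointP => x /(fsubsetP sX).
  by rewrite !inE => /andP[xA _]; apply: contra xA; exact: (fsubsetP sBA).
split=> [I|||I J]; rewrite ?(contr_indepE _ bB).
- by case/andP.
- by rewrite fsub0set fset0U.
- move=> I J; rewrite !(contr_indepE _ bB) => /andP[sJ iJ] sIJ.
  by rewrite (fsubset_trans sIJ) //= (indepS iJ) // fsetSU.
- move=> /andP[sI iI] /andP[sJ iJ] ltIJ.
  have [|x] := indep_aug iI iJ; first by rewrite !cU // ltn_add2r.
  rewrite !inE negb_or => /andP[/andP[xI xB]]; rewrite (negPf xB) orbF => xJ ix.
  exists x; first by rewrite !inE xI xJ.
  rewrite (contr_indepE _ bB) -fsetUA ix andbT; apply/fsubsetP => y.
  by rewrite in_fset1U => /orP[/eqP->|]; [exact: (fsubsetP sJ)|exact: (fsubsetP sI)].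
Qed.

Definition contr A : matroid := Matroid (contr_is_matroid A).

End MatroidTheory.

Lemma mem_restr M A I :
  (I \in indep (restr M A)) = (I \in indep M) && (I `<=` A).
Proof. by rewrite /= !inE. Qed.

Lemma mem_contr M A B I : basis_of M A B ->
  (I \in indep (contr M A)) = (I `<=` ground M `\` A) && (I `|` B \in indep M).
Proof. exact: contr_indepE. Qed.

Lemma basis_restr M A B X : A `<=` B ->
  basis_of (restr M B) A X <-> basis_of M A X.
Proof.
move=> sAB; split=> -[iX sX mX].
  move: iX; rewrite mem_restr => /andP[iX sXB]; split=> // Y iY sXY sYA.
  by apply: mX => //; rewrite mem_restr iY (fsubset_trans sYA).
split=> //; first by rewrite mem_restr iX (fsubset_trans sX).
by move=> Y; rewrite mem_restr => /andP[iY _]; exact: mX.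
Qed.

Lemma basis_contr M A B X Y : A `<=` B ->
  basis_of M A X -> basis_of (contr M A) (B `\` A) Y -> basis_of M B (Y `|` X).
Proof.
move=> sAB bX [iY sY mY]; have [iX sX mX] := bX.
move: iY; rewrite (mem_contr _ bX) => /andP[sYg iYX].
split=> // [|Z iZ sYXZ sZB].
  rewrite fsubUset (fsubset_trans sX) // andbT.
  exact: fsubset_trans sY (fsubsetDl _ _).
have ZA : Z `&` A = X.
  apply: mX; rewrite ?fsubsetIr //; first exact: indepS iZ (fsubsetIl _ _).
  by rewrite fsubsetI sX andbT (fsubset_trans _ sYXZ) // fsubsetUr.
have eZ : Z = Z `\` A `|` X by rewrite -{1}(fsetID A Z) ZA fsetUC.
have ZY : Z `\` A = Y.
  apply: mY; last exact: fsetSD.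
    rewrite (mem_contr _ bX) -eZ iZ andbT; apply: fsetSD.
    exact: indep_sub iZ.
  apply/fsubsetP => x xY; move/fsubsetP: sY => /(_ x xY); rewrite !inE.
  move=> /andP[-> _] /=; apply: (fsubsetP sYXZ); by rewrite inE xY.
by rewrite eZ ZY.
Qed.

Lemma restr_restr M A B : A `<=` B -> restr (restr M B) A = restr M A.
Proof.
move=> sAB; apply: matroid_eq => /= [|I].
  by rewrite -fsetIA (fsetIidPr sAB).
rewrite !mem_restr; case sIA: (I `<=` A); rewrite ?andbF ?andbT //.
by rewrite (fsubset_trans sIA sAB) andbT.
Qed.

Lemma restr_contr M A B : A `<=` B ->
  restr (contr M A) (B `\` A) = contr (restr M B) A.
Proof.
move=> sAB; have [X bX] := basis_exists M A.
have bX' := (basis_restr _ _ sAB).2 bX; have [iX sX _] := bX.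
apply: matroid_eq => [|I].
  by apply/fsetP => x; rewrite !inE; do !case: (_ \in _).
rewrite [RHS](mem_contr _ bX') !mem_restr (mem_contr _ bX).
rewrite /= fsubUset (fsubset_trans sX sAB) andbT.
case: (I `|` X \in _); rewrite ?andbF ?andbT //=.
apply/andP/andP => [[s1 s2]|[s1 s2]]; split.
- apply/fsubsetP => x xI; move: (fsubsetP s1 _ xI) (fsubsetP s2 _ xI).
  by rewrite !inE; do !case: (_ \in _).
- exact: fsubset_trans s2 (fsubsetDl _ _).
- by apply: fsubset_trans s1 _; apply/fsubsetP => x; rewrite !inE; do !case: (_ \in _).
- by apply: fsubset_trans s1 _; apply/fsubsetP => x; rewrite !inE; do !case: (_ \in _).
Qed.

Lemma contr_contr M A B : A `<=` B ->
  contr (contr M A) (B `\` A) = contr M B.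
Proof.
move=> sAB; have [X bX] := basis_exists M A.
have [Y bY] := basis_exists (contr M A) (B `\` A).
have bYX := basis_contr sAB bX bY.
have eg : ground M `\` A `\` (B `\` A) = ground M `\` B.
  apply/fsetP => x; rewrite !inE; have := fsubsetP sAB x.
  by case: (x \in A) => [->|_] //; rewrite andbT.
apply: matroid_eq => [//|I].
rewrite [LHS](mem_contr _ bY) [RHS](mem_contr _ bYX) /= eg.
rewrite (mem_contr _ bX) fsubUset -fsetUA.
have [sI /=|//] := boolP (I `<=` ground M `\` B).
have [iYX|] := boolP (_ \in indep M); rewrite ?andbF ?andbT //.
have [iY _ _] := bY; apply/andP; split; last exact: indep_sub iY.
by apply: fsubset_trans sI _; apply: fsetDS.
Qed.

Definition is_iso (f : nat -> nat) (M N : matroid) : Prop :=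
  [/\ {in ground M &, injective f}, f @` ground M = ground N &
      forall I, I `<=` ground M -> (f @` I \in indep N) = (I \in indep M)].

Definition iso (M N : matroid) : bool := `[< exists f, is_iso f M N >].

Lemma im_mono (f : nat -> nat) (I J : {fset nat}) :
  I `<=` J -> f @` I `<=` f @` J.
Proof.
move=> sIJ; apply/fsubsetP => y /imfsetP[x /= xI ->]; apply/imfsetP.
by exists x => //; exact: (fsubsetP sIJ).
Qed.

Section ImageSets.
Variables (f : nat -> nat) (S : {fset nat}).
Hypothesis injf : {in S &, injective f}.
Implicit Types I J : {fset nat}.

Lemma im_mem I x : I `<=` S -> x \in S -> (f x \in f @` I) = (x \in I).
Proof.
move=> sI xS; apply/imfsetP/idP => [[y /= yI efx]|xI]; last by exists x.
by rewrite (injf xS _ efx) //; exact: (fsubsetP sI).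
Qed.

Lemma im_sub I J : I `<=` S -> J `<=` S -> (f @` I `<=` f @` J) = (I `<=` J).
Proof.
move=> sI sJ; apply/idP/idP => [sIJ|sIJ]; last exact: im_mono.
apply/fsubsetP => x xI; rewrite -(im_mem sJ) ?(fsubsetP sI) //.
by apply: (fsubsetP sIJ); apply/imfsetP; exists x.
Qed.

Lemma im_inj I J : I `<=` S -> J `<=` S -> f @` I = f @` J -> I = J.
Proof.
by move=> sI sJ e; apply/eqP; rewrite eqEfsubset -(im_sub sI sJ) -(im_sub sJ sI) e fsubset_refl.
Qed.

Lemma im_card I : I `<=` S -> #|` f @` I| = #|` I|.
Proof.
move=> sI; apply: card_in_imfset => x y /= xI yI.
by apply: injf; exact: (fsubsetP sI).
Qed.

Lemma im_D I J : I `<=` S -> J `<=` S -> f @` (I `\` J) = f @` I `\` f @` J.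
Proof.
move=> sI sJ; apply/fsetP => y; rewrite in_fsetD; apply/imfsetP/andP => /=.
  move=> [x]; rewrite !inE => /andP[xJ xI] ->.
  have xS := fsubsetP sI _ xI; rewrite im_mem // xJ; split=> //.
  by apply/imfsetP; exists x.
move=> [yJ /imfsetP[x /= xI ey]]; subst y; exists x => //.
by move: yJ; rewrite im_mem ?(fsubsetP sI) // !inE => ->.
Qed.

Lemma im_pre J : J `<=` f @` S -> exists2 I, I `<=` S & J = f @` I.
Proof.
move=> sJ; exists [fset x in S | f x \in J].
  by apply/fsubsetP => x; rewrite !inE => /andP[].
apply/fsetP => y; apply/idP/imfsetP => [yJ|[x]]; last first.
  by rewrite !inE /= => /andP[_ ?] ->.
have /imfsetP[x /= xS ey] := fsubsetP sJ _ yJ.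
by exists x => //; rewrite !inE /= xS -ey.
Qed.

End ImageSets.

Lemma iso_refl M : iso M M.
Proof.
apply/asboolP; exists id; split=> //; first exact: imfset_id.
by move=> I _; rewrite imfset_id.
Qed.

Lemma is_iso_trans f g M N P :
  is_iso f M N -> is_iso g N P -> is_iso (g \o f) M P.
Proof.
move=> [injf ef jf] [injg eg jg].
have fg x : x \in ground M -> f x \in ground N.
  by move=> xM; rewrite -ef; apply/imfsetP; exists x.
split=> [x y xM yM /= e||I sI].
- by apply: injf => //; apply: injg => //; exact: fg.
- by rewrite imfset_comp ef.
- rewrite imfset_comp jg ?jf // -ef; exact: im_mono.
Qed.

Lemma iso_trans : transitive iso.
Proof.
move=> N M P /asboolP[f isof] /asboolP[g isog]; apply/asboolP.
by exists (g \o f); exact: is_iso_trans isog.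
Qed.

Lemma iso_imp_sym M N : iso M N -> iso N M.
Proof.
move=> /asboolP[f [injf ef jf]]; apply/asboolP.
pose g y := nth 0 (ground M) (find (fun x => f x == y) (ground M)).
have gP x : x \in ground M -> g (f x) = x.
  move=> xM; have h : has (fun z => f z == f x) (ground M).
    by apply/hasP; exists x => /=.
  apply: injf => //; first by rewrite /g mem_nth // -has_find.
  by apply/eqP; exact: (nth_find 0 h).
have gI I : I `<=` ground M -> g @` (f @` I) = I.
  move=> sI; rewrite -imfset_comp -[RHS]imfset_id.
  by apply: eq_in_imfset => x /= xI; rewrite gP // (fsubsetP sI).
exists g; split=> [x y||I].
- rewrite -ef => /imfsetP[x' /= x'M ->] /imfsetP[y' /= y'M ->].
  by rewrite !gP // => ->.
- by rewrite -ef gI.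
- by rewrite -ef => /im_pre[J sJ ->]; rewrite gI // jf.
Qed.

Lemma iso_sym : symmetric iso.
Proof. by move=> M N; apply/idP/idP; exact: iso_imp_sym. Qed.

Lemma is_iso_restr f M N A : A `<=` ground M ->
  is_iso f M N -> is_iso f (restr M A) (restr N (f @` A)).
Proof.
move=> sA [injf ef jf]; split=> /=.
- by move=> x y; rewrite !inE => /andP[xM _] /andP[yM _]; exact: injf.
- rewrite (fsetIidPr sA) -ef; apply/esym/fsetIidPr; exact: im_mono.
- rewrite (fsetIidPr sA) => I sI; have sIM := fsubset_trans sI sA.
  by rewrite !inE /= jf // (im_sub injf).
Qed.

Lemma is_iso_basis f M N A B : A `<=` ground M ->
  is_iso f M N -> basis_of M A B -> basis_of N (f @` A) (f @` B).
Proof.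
move=> sA [injf ef jf] [iB sB mB]; have sBM := fsubset_trans sB sA.
split; rewrite ?jf ?(im_sub injf) // => Y iY; have := indep_sub iY.
rewrite -ef => sY; have [I sI eY] := im_pre sY.
move: iY; rewrite {}eY jf // => iI; rewrite !(im_sub injf) // => ? ?.
by rewrite (mB I).
Qed.

Lemma is_iso_contr f M N A : A `<=` ground M ->
  is_iso f M N -> is_iso f (contr M A) (contr N (f @` A)).
Proof.
move=> sA isof; have [injf ef jf] := isof; have [B bB] := basis_exists M A.
have bB' := is_iso_basis sA isof bB; have [iB _ _] := bB.
split=> /= [x y||I sI].
- by rewrite !inE => /andP[_ xM] /andP[_ yM]; exact: injf.
- by rewrite -ef (im_D injf).
- have sIM := fsubset_trans sI (fsubsetDl _ _).
  rewrite (contr_indepE _ bB) (contr_indepE _ bB') -ef -(im_D injf) // -imfsetU jf.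
    by rewrite (im_sub injf) // fsubsetDl.
  by rewrite fsubUset sIM (indep_sub iB).
Qed.

Definition section_coef (M N1 N2 : matroid) : nat :=
  #|` [fset A in fpowerset (ground M) | iso (restr M A) N1 && iso (contr M A) N2]|.

Definition iso_equiv := EquivRel iso iso_refl iso_sym iso_trans.
Definition iso_class := {eq_quot iso_equiv}%qT.
HB.instance Definition _ := Choice.on iso_class.

Definition class_of (M : matroid) : iso_class := (\pi_iso_class M)%qT.
Definition class_repr (c : iso_class) : matroid := repr c.

Lemma class_eq M N : (class_of M == class_of N) = iso M N.
Proof. by apply/eqP/idP => /(eqmodP iso_equiv M N). Qed.

Lemma class_reprK c : class_of (class_repr c) = c.
Proof. exact: reprK. Qed.

Lemma iso_class_repr M : iso (class_repr (class_of M)) M.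
Proof. by rewrite -class_eq class_reprK. Qed.

Lemma null_is_matroid (S : {fset nat}) : is_matroid S [fset fset0].
Proof.
split=> [I|||I J]; rewrite ?inE //.
- by move=> /eqP->; exact: fsub0set.
- by move=> I J; rewrite !inE => /eqP->; rewrite fsubset0.
- by move=> /eqP-> /eqP->; rewrite ltnn.
Qed.

Definition null_matroid (S : {fset nat}) := Matroid (null_is_matroid S).

Lemma free_is_matroid (S : {fset nat}) : is_matroid S (fpowerset S).
Proof.
split=> [I|||I J]; rewrite ?fpowersetE ?fsub0set //.
- by move=> I J; rewrite !fpowersetE => sJ sIJ; exact: fsubset_trans sJ.
- move=> sI sJ ltIJ; have : ~~ (J `<=` I).
    by apply: contraL ltIJ => /fsubset_leq_card; rewrite -leqNgt.
  case/fsubsetPn => x xJ xI; exists x; first by rewrite !inE xI.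
  by rewrite fpowersetE fsubUset fsub1set (fsubsetP sJ).
Qed.

Definition free_matroid (S : {fset nat}) := Matroid (free_is_matroid S).

Definition empty_matroid : matroid := null_matroid fset0.
Definition loop : matroid := null_matroid [fset 0].
Definition point : matroid := free_matroid [fset 0].

Lemma card_iso M N : iso M N -> #|` ground M| = #|` ground N|.
Proof. by move=> /asboolP[f [injf <- _]]; rewrite (im_card injf). Qed.

Lemma section_coef_card M N1 N2 : section_coef M N1 N2 != 0%N ->
  #|` ground M| = (#|` ground N1| + #|` ground N2|)%N.
Proof.
rewrite -lt0n cardfs_gt0 => /fset0Pn[A]; rewrite !inE /= fpowersetE.
move=> /and3P[sA /card_iso <- /card_iso <-] /=.
by rewrite (fsetIidPr sA) -[LHS](cardfsID A) (fsetIidPr sA).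
Qed.

Lemma im_is_matroid f M : {in ground M &, injective f} ->
  is_matroid (f @` ground M) [fset f @` I | I : {fset nat} in indep M].
Proof.
move=> injf; split.
- by move=> _ /imfsetP[I /= iI ->]; apply: im_mono; exact: indep_sub.
- by apply/imfsetP; exists fset0; rewrite ?imfset0 //= indep0.
- move=> I _ /imfsetP[J /= iJ ->] sIJ; have sJ := indep_sub iJ.
  have [|I' sI' eI] := @im_pre f (ground M) I.
    by apply: fsubset_trans sIJ _; exact: im_mono.
  apply/imfsetP; exists I' => //=; apply: indepS iJ _.
  by move: sIJ; rewrite eI (im_sub injf).
- move=> _ _ /imfsetP[I /= iI ->] /imfsetP[J /= iJ ->].
  have sI := indep_sub iI; have sJ := indep_sub iJ.
  rewrite !(im_card injf) // => /(indep_aug iI iJ)[x xJI ixI].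
  exists (f x); first by rewrite -(im_D injf) //; apply/imfsetP; exists x.
  by apply/imfsetP; exists (x |` I) => //=; rewrite imfsetU1.
Qed.

Lemma iso_iota M : exists2 N, iso M N & ground N = [fset x in iota 0 #|` ground M|].
Proof.
pose f x := index x (ground M).
have injf : {in ground M &, injective f}.
  by move=> x y xM yM; exact: (index_inj 0%N).
exists (Matroid (im_is_matroid injf)) => /=.
  apply/asboolP; exists f; split=> // I sI /=.
  apply/imfsetP/idP => [[J /= iJ]|iI]; last by exists I.
  by move/(im_inj injf sI (indep_sub iJ)) ->.
apply/fsetP => y; rewrite !inE /= mem_iota /= add0n; apply/imfsetP/idP => [[x /= xM ->]|yM].
  by rewrite index_mem.
by exists (nth 0%N (ground M) y); rewrite /= ?mem_nth // /f index_uniq.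
Qed.

Lemma finite_matroids_on S : finite_set [set M | ground M = S]%classic.
Proof.
pose g (D : {fset {fset nat}}) := match pselect (is_matroid S D) with | left H => Matroid H | right _ => null_matroid S end.
apply: sub_finite_set (finite_image g (finite_fset (fpowerset (fpowerset S)))).
move=> M /= eM; subst S; exists (indep M) => /=.
  by rewrite fpowersetE; apply/fsubsetP => I iI; rewrite fpowersetE indep_sub.
rewrite /g; case: pselect => [H|[]]; last exact: matroidP.
exact: matroid_eq.
Qed.

(* in_class_empty only excludes the empty class: it is needed for the unit. *)
Record minor_closed_class := MinorClosedClass {
  in_class :> matroid -> Prop;
  in_class_iso : forall M N, iso M N -> in_class M -> in_class N;
  in_class_restr : forall M A, A `<=` ground M -> in_class M -> in_class (restr M A);
  in_class_contr : forall M A, A `<=` ground M -> in_class M -> in_class (contr M A);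
  in_class_empty : in_class empty_matroid
}.

Definition iso_class_in (C : minor_closed_class) : Type :=
  {c : iso_class | `[< C (class_repr c) >]}.
HB.instance Definition _ C := Choice.on (iso_class_in C).

Definition repr_in (C : minor_closed_class) (c : iso_class_in C) : matroid :=
  class_repr (val c).

Lemma class_of_in (C : minor_closed_class) M : C M ->
  `[< C (class_repr (class_of M)) >].
Proof.
by move=> CM; apply/asboolP/(in_class_iso _ CM); rewrite iso_sym iso_class_repr.
Qed.

Definition class_in (C : minor_closed_class) M (CM : C M) : iso_class_in C :=
  Sub (class_of M) (class_of_in CM).

Lemma iso_repr_in (C : minor_closed_class) M (CM : C M) : iso (repr_in (class_in CM)) M.
Proof. by rewrite /repr_in SubK iso_class_repr. Qed.

Lemma repr_in_class (C : minor_closed_class) (c : iso_class_in C) : C (repr_in c).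
Proof. by apply/asboolP; exact: (valP c). Qed.

Lemma repr_inK (C : minor_closed_class) (c c' : iso_class_in C) :
  iso (repr_in c) (repr_in c') = (c == c').
Proof. by rewrite -class_eq !class_reprK. Qed.

Lemma finite_section (C : minor_closed_class) (N1 N2 : matroid) :
  finite_set [set c : iso_class_in C | section_coef (repr_in c) N1 N2 != 0%N]%classic.
Proof.
pose S := [fset x in iota 0 (#|` ground N1| + #|` ground N2|)].
pose g M : iso_class_in C := match pselect (C M) with
  left H => class_in H | right _ => class_in (in_class_empty C) end.
apply: sub_finite_set (finite_image g (finite_matroids_on S)) => c /= sc.
have [N isoN gN] := iso_iota (repr_in c); exists N.
  by rewrite /= gN (section_coef_card sc).
rewrite /g; case: pselect => [H|[]]; last exact: in_class_iso isoN (repr_in_class c).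
by apply/eqP; rewrite -repr_inK (iso_trans (iso_repr_in H)) // iso_sym.
Qed.

Import GRing.Theory.
Local Open Scope ring_scope.

(* The free K-module on the isomorphism classes of C, with the product of     *)
(* basis elements N1 . N2 = \sum_M binom(M; N1, N2) M extended bilinearly.     *)
(* The sum over all classes is a sum of finite support by finite_section;     *)
(* see basis_mulE.                                                            *)
Definition matroid_algebra (K : comNzRingType) (C : minor_closed_class) : Type :=
  {malg K[iso_class_in C]}.

HB.instance Definition _ K C := GRing.Lmodule.on (matroid_algebra K C).

Section MatroidAlgebra.
Variables (K : comNzRingType) (C : minor_closed_class).
Local Notation A := (matroid_algebra K C).
Implicit Types (f g h : A) (c N : iso_class_in C).

Definition basis_elt c : A := << 1 *g c >>.

Definition basis_mul N1 N2 : A :=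
  \sum_(M \in [set: iso_class_in C]%classic)
     (section_coef (repr_in M) (repr_in N1) (repr_in N2))%:R *: basis_elt M.

Definition alg_mul f g : A :=
  \sum_(N1 <- msupp f) \sum_(N2 <- msupp g) (f@_N1 * g@_N2) *: basis_mul N1 N2.

Definition alg_one : A := basis_elt (class_in (in_class_empty C)).

Lemma basis_mulE N1 N2 c :
  (basis_mul N1 N2)@_c = (section_coef (repr_in c) (repr_in N1) (repr_in N2))%:R.
Proof.
have fin := finite_section C (repr_in N1) (repr_in N2).
set D := [set c' | _]%classic in fin.
have notD c' : c' \notin fset_set D ->
    section_coef (repr_in c') (repr_in N1) (repr_in N2) = 0%N.
  by rewrite in_fset_set // notin_setE /D /= => /negP; rewrite negbK => /eqP.
rewrite /basis_mul (fsbigE (enum_fset (fset_set D))) //; last first.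
  by move=> M _ /notD ->; rewrite scale0r.
rewrite raddf_sum /=.
under eq_bigr do rewrite mcoeffZ mcoeffU.
under eq_bigl do rewrite in_setT.
have [cS|cS] := boolP (c \in fset_set D).
  rewrite (big_fsetD1 c) //= eqxx mulr1 big1_seq ?addr0 // => M /andP[_].
  by rewrite !inE => /andP[/negPf -> _]; rewrite mulr0.
rewrite big1_seq => [|M /andP[_ MS]]; first by rewrite (notD _ cS).
by case: eqP MS cS => [->|_ _ _]; [move=> ->|rewrite mulr0].
Qed.

(* Coefficient of f at the isomorphism class of M, zero when M is not in C. *)
Definition coef_at f M : K :=
  if insub (class_of M) is Some c then f@_c else 0.

Lemma coef_at_iso f (M N : matroid) : iso M N -> coef_at f M = coef_at f N.
Proof. by rewrite -class_eq /coef_at => /eqP ->. Qed.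

Lemma coef_at_repr f c : coef_at f (repr_in c) = f@_c.
Proof. by rewrite /coef_at /repr_in class_reprK valK. Qed.

Lemma coef_at_in f M (CM : C M) : coef_at f M = f@_(class_in CM).
Proof. by rewrite -coef_at_repr; apply: coef_at_iso; rewrite iso_sym iso_repr_in. Qed.

Lemma coef_at_sum f M : C M ->
  \sum_(N <- msupp f) f@_N * (iso M (repr_in N))%:R = coef_at f M.
Proof.
move=> CM; rewrite (coef_at_in _ CM).
have e N : iso M (repr_in N) = (class_in CM == N).
  rewrite -repr_inK; apply/idP/idP; apply: iso_trans; first exact: iso_repr_in.
  by rewrite iso_sym iso_repr_in.
under eq_bigr do rewrite e.
have [cS|cS] := boolP (class_in CM \in msupp f).
  rewrite (big_fsetD1 (class_in CM)) //= eqxx mulr1 big1_seq ?addr0 // => N /andP[_].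
  by rewrite !inE eq_sym => /andP[/negPf -> _]; rewrite mulr0.
rewrite (mcoeff_outdom cS) big1_seq // => N /andP[_ NS].
by case: eqP NS cS => [->|_ _ _]; [move=> ->|rewrite mulr0].
Qed.

Definition coproduct_sum f g M : K :=
  \sum_(X <- fpowerset (ground M)) coef_at f (restr M X) * coef_at g (contr M X).

Lemma section_coefE M N1 N2 : (section_coef M (repr_in N1) (repr_in N2))%:R =
  \sum_(X <- fpowerset (ground M))
    (iso (restr M X) (repr_in N1))%:R * (iso (contr M X) (repr_in N2))%:R :> K.
Proof.
under eq_bigr do rewrite -natrM mulnb.
rewrite -natr_sum; congr _%:R; rewrite /section_coef card_fset_sum1.
rewrite [LHS]big_fset /= big_mkcond; apply: eq_bigr => X _.
by case: (_ && _).
Qed.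

Lemma alg_mulE f g c : (alg_mul f g)@_c = coproduct_sum f g (repr_in c).
Proof.
rewrite /alg_mul raddf_sum /=; under eq_bigr do rewrite raddf_sum /=.
under eq_bigr => N1 _ do under eq_bigr => N2 _ do
  rewrite mcoeffZ basis_mulE section_coefE mulr_sumr.
under eq_bigr do rewrite exchange_big /=.
rewrite exchange_big /= /coproduct_sum; apply: eq_big_seq => X.
rewrite fpowersetE => sX; have Cc := repr_in_class c.
rewrite -(coef_at_sum _ (in_class_restr sX Cc)) -(coef_at_sum _ (in_class_contr sX Cc)).
rewrite mulr_suml; apply: eq_bigr => N1 _; rewrite mulr_sumr; apply: eq_bigr => N2 _.
by rewrite mulrACA.
Qed.

Lemma sum_iso (F : matroid -> matroid -> K) (M N : matroid) :
  (forall P P' Q Q', iso P P' -> iso Q Q' -> F P Q = F P' Q') -> iso M N ->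
  \sum_(X <- fpowerset (ground M)) F (restr M X) (contr M X) =
  \sum_(X <- fpowerset (ground N)) F (restr N X) (contr N X).
Proof.
move=> isoF /asboolP[f isof]; have [injf ef _] := isof.
have -> : fpowerset (ground N) = [fset (f @` X) | X : {fset nat} in fpowerset (ground M)].
  apply/fsetP => Y; rewrite fpowersetE -ef; apply/idP/imfsetP.
    by case/im_pre => X sX ->; exists X => //=; rewrite fpowersetE.
  by case=> X /=; rewrite fpowersetE => sX ->; exact: im_mono.
rewrite [RHS]big_imfset /=; last first.
  by move=> X Y /=; rewrite !fpowersetE; exact: (im_inj injf).
apply: eq_big_seq => X; rewrite fpowersetE => sX; apply: isoF; apply/asboolP.
  by exists f; exact: is_iso_restr.
by exists f; exact: is_iso_contr.
Qed.

Lemma coproduct_sum_iso f g (M N : matroid) : iso M N ->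
  coproduct_sum f g M = coproduct_sum f g N.
Proof.
apply: (sum_iso (F := fun P Q => coef_at f P * coef_at g Q)) => P P' Q Q'.
by move=> /coef_at_iso -> /coef_at_iso ->.
Qed.

Lemma coef_at_mul f g M : C M -> coef_at (alg_mul f g) M = coproduct_sum f g M.
Proof.
move=> CM; rewrite (coef_at_in _ CM) alg_mulE.
by apply: coproduct_sum_iso; exact: iso_repr_in.
Qed.

Lemma alg_mulA : associative alg_mul.
Proof.
move=> f g h; apply/malgP => c.
rewrite [LHS]alg_mulE [RHS]alg_mulE /coproduct_sum.
set M := repr_in c; have CM : C M := repr_in_class c; set S := ground M.
transitivity (\sum_(X <- fpowerset S) \sum_(Y <- fpowerset S | X `<=` Y)
  coef_at f (restr M X) * coef_at g (contr (restr M Y) X) * coef_at h (contr M Y)).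
  apply: eq_big_seq => X; rewrite fpowersetE => sX.
  rewrite coef_at_mul; last exact: in_class_contr.
  rewrite /coproduct_sum mulr_sumr /= -/S.
  have -> : fpowerset (S `\` X) =
      [fset Y `\` X | Y : {fset nat} in [fset Y in fpowerset S | X `<=` Y]].
    apply/fsetP => Z; rewrite fpowersetE; apply/idP/imfsetP => [sZ|].
      exists (X `|` Z); last first.
        rewrite fsetDUl fsetDv fset0U; apply/esym/fsetDidPl.
        by apply/fdisjointP => x /(fsubsetP sZ); rewrite !inE => /andP[].
      rewrite !inE /= fpowersetE fsubsetUl andbT fsubUset sX /=.
      exact: fsubset_trans sZ (fsubsetDl _ _).
    case=> Y /=; rewrite !inE /= fpowersetE => /andP[sY _] ->; exact: fsetSD.
  rewrite [LHS]big_imfset /=; last first.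
    move=> Y Y' /=; rewrite !inE /= => /andP[_ sXY] /andP[_ sXY'] e.
    by rewrite -(fsetID X Y) -(fsetID X Y') (fsetIidPr sXY) (fsetIidPr sXY') e.
  rewrite big_fset /= big_seq_cond [RHS]big_seq_cond; apply: eq_bigr => Y /andP[_ sXY].
  by rewrite restr_contr // contr_contr // mulrA.
rewrite (exchange_big_dep predT) //=; apply: eq_big_seq => Y; rewrite fpowersetE => sY.
rewrite coef_at_mul; last exact: in_class_restr.
rewrite /coproduct_sum mulr_suml /= -/S (fsetIidPr sY).
have -> : fpowerset Y = [fset X in fpowerset S | X `<=` Y].
  apply/fsetP => X; rewrite !inE /= !fpowersetE.
  by have [sX|] := boolP (X `<=` Y); rewrite ?andbF ?andbT //; rewrite (fsubset_trans sX).
rewrite big_fset /=; apply: eq_bigr => X sXY.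
by rewrite restr_restr.
Qed.

Lemma coef_at_one M : coef_at alg_one M = (ground M == fset0)%:R.
Proof.
have iso0 (N : matroid) : iso empty_matroid N = (ground N == fset0).
  apply/idP/idP => [/card_iso/esym/eqP|/eqP gN].
    by rewrite cardfs0 cardfs_eq0.
  apply/asboolP; exists id; split=> //=; first by rewrite imfset_id gN.
  move=> I; rewrite fsubset0 => /eqP ->.
  by rewrite imfset0 indep0 !inE eqxx.
have [CM|nCM] := pselect (C M).
  rewrite (coef_at_in _ CM) mcoeffU -iso0; congr (_ *+ nat_of_bool _).
  rewrite -repr_inK; apply/idP/idP => e.
    apply: iso_trans (iso_repr_in CM); apply: iso_trans e.
    by rewrite iso_sym iso_repr_in.
  apply: iso_trans (iso_repr_in _) _; apply: iso_trans e _.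
  by rewrite iso_sym iso_repr_in.
rewrite /coef_at; case: insubP => [c /asboolP Cc|_].
  by case: nCM; apply: in_class_iso (iso_class_repr M) Cc.
case: eqP => // gM; case: nCM; apply: in_class_iso (in_class_empty C).
by rewrite iso0 gM.
Qed.

Lemma alg_mul1r : left_id alg_one alg_mul.
Proof.
move=> f; apply/malgP => c; rewrite alg_mulE /coproduct_sum.
set M := repr_in c; have CM : C M := repr_in_class c.
rewrite (big_fsetD1 fset0) ?fpowersetE ?fsub0set //= big1_seq ?addr0.
  rewrite coef_at_one /= fsetI0 eqxx mul1r -coef_at_repr; congr coef_at.
  have b0 : basis_of M fset0 fset0.
    by split; rewrite ?indep0 ?fsubset_refl // => B _ _; rewrite fsubset0 => /eqP.
  apply: matroid_eq => [|I]; first by rewrite /= fsetD0.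
  rewrite (mem_contr _ b0) fsetU0 fsetD0.
  by case iI: (_ \in _); rewrite ?andbF // (indep_sub iI).
move=> X /andP[_]; rewrite !inE fpowersetE => /andP[nX sX].
by rewrite coef_at_one /= (fsetIidPr sX) (negPf nX) mul0r.
Qed.

Lemma alg_mulr1 : right_id alg_one alg_mul.
Proof.
move=> f; apply/malgP => c; rewrite alg_mulE /coproduct_sum.
set M := repr_in c; have CM : C M := repr_in_class c.
rewrite (big_fsetD1 (ground M)) ?fpowersetE ?fsubset_refl //= big1_seq ?addr0.
  rewrite coef_at_one /= fsetDv eqxx mulr1 -coef_at_repr; congr coef_at.
  apply: matroid_eq => [|I]; first by rewrite /= fsetIid.
  by rewrite mem_restr; case iI: (_ \in _); rewrite // (indep_sub iI).
move=> X /andP[_]; rewrite !inE fpowersetE => /andP[nX sX].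
rewrite coef_at_one /= fsetD_eq0 [_ `<=` X](_ : _ = false) ?mulr0 //.
by apply: contraNF nX => sX'; rewrite eqEfsubset sX.
Qed.

Lemma coef_atD f g M : coef_at (f + g) M = coef_at f M + coef_at g M.
Proof. by rewrite /coef_at; case: insub => [c|]; rewrite ?mcoeffD ?addr0. Qed.

Lemma coef_atZ a f M : coef_at (a *: f) M = a * coef_at f M.
Proof. by rewrite /coef_at; case: insub => [c|]; rewrite ?mcoeffZ ?mulr0. Qed.

Lemma alg_mulDl : left_distributive alg_mul +%R.
Proof.
move=> f g h; apply/malgP => c; rewrite [LHS]alg_mulE [RHS]mcoeffD.
rewrite [RHS](f_equal2 +%R (alg_mulE f h c) (alg_mulE g h c)) /coproduct_sum -big_split /=.
by apply: eq_bigr => X _; rewrite coef_atD mulrDl.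
Qed.

Lemma alg_mulDr : right_distributive alg_mul +%R.
Proof.
move=> f g h; apply/malgP => c; rewrite [LHS]alg_mulE [RHS]mcoeffD.
rewrite [RHS](f_equal2 +%R (alg_mulE f g c) (alg_mulE f h c)) /coproduct_sum -big_split /=.
by apply: eq_bigr => X _; rewrite coef_atD mulrDr.
Qed.

Lemma alg_one_neq0 : alg_one != 0.
Proof.
apply/eqP => /(congr1 (coef_at ^~ empty_matroid)); rewrite coef_at_one eqxx.
rewrite /coef_at; case: insub => [c|]; rewrite ?mcoeff0; exact/eqP/oner_neq0.
Qed.

HB.instance Definition _ := GRing.Zmodule_isNzRing.Build A
  alg_mulA alg_mul1r alg_mulr1 alg_mulDl alg_mulDr alg_one_neq0.

Lemma basis_eltM N1 N2 : basis_elt N1 * basis_elt N2 = basis_mul N1 N2.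
Proof.
have -> : basis_elt N1 * basis_elt N2 = alg_mul (basis_elt N1) (basis_elt N2) by [].
rewrite /alg_mul /basis_elt !msuppU (negPf (oner_neq0 K)) !big_seq_fset1.
by rewrite !mcoeffUU mulr1 scale1r.
Qed.

Lemma alg_scalerAl a f g : a *: (f * g) = a *: f * g.
Proof.
apply/malgP => c; rewrite [LHS]mcoeffZ [LHS](f_equal ( *%R a) (alg_mulE f g c)) [RHS]alg_mulE /coproduct_sum mulr_sumr.
by apply: eq_bigr => X _; rewrite coef_atZ mulrA.
Qed.

HB.instance Definition _ := GRing.Lmodule_isLalgebra.Build K A alg_scalerAl.

Lemma alg_scalerAr a f g : a *: (f * g) = f * (a *: g).
Proof.
apply/malgP => c; rewrite [LHS]mcoeffZ [LHS](f_equal ( *%R a) (alg_mulE f g c)) [RHS]alg_mulE /coproduct_sum mulr_sumr.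
by apply: eq_bigr => X _; rewrite coef_atZ mulrCA.
Qed.

HB.instance Definition _ := GRing.Lalgebra_isAlgebra.Build K A alg_scalerAr.

End MatroidAlgebra.

Local Close Scope ring_scope.

(* A flag (S_0, ..., S_r) is the list of its r.+1 members. *)
Definition is_flag (S : {fset nat}) (F : seq {fset nat}) : bool :=
  [&& F != [::], sorted (fun A B => A `<` B) F & last fset0 F == S].

Definition freedom_indep (S : {fset nat}) (F : seq {fset nat}) : {fset {fset nat}} :=
  [fset I in fpowerset S |
     [forall i : 'I_(size F), #|` I `&` nth fset0 F i| <= i]].

Lemma freedom_indepP S F I :
  reflect (I `<=` S /\ forall i, i < size F -> #|` I `&` nth fset0 F i| <= i)
          (I \in freedom_indep S F).
Proof.
rewrite !inE /= fpowersetE; apply: (iffP andP) => -[sI H]; split=> //.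
  by move=> i ltiF; have /forallP/(_ (Ordinal ltiF)) := H.
by apply/forallP => i; exact: H.
Qed.

Lemma flag_mono S F i j : is_flag S F -> i <= j -> j < size F ->
  nth fset0 F i `<=` nth fset0 F j.
Proof.
case/and3P => _ sF _ leij ltj.
have tr : transitive (fun A B : {fset nat} => A `<=` B).
  by move=> B A D; exact: fsubset_trans.
have sF' : sorted (fun A B : {fset nat} => A `<=` B) F.
  by apply: sub_sorted sF => A B; exact: fproper_sub.
apply: (sorted_leq_nth tr (@fsubset_refl _) fset0 sF') => //.
by rewrite inE (leq_ltn_trans leij).
Qed.

Lemma flag_last S F : is_flag S F -> nth fset0 F (size F).-1 = S.
Proof. by case/and3P => _ _ /eqP <-; rewrite nth_last. Qed.

Lemma flag_size S F : is_flag S F -> 0 < size F.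
Proof. by case/and3P; rewrite -size_eq0 lt0n. Qed.

Lemma freedom_is_matroid S F : is_flag S F -> is_matroid S (freedom_indep S F).
Proof.
move=> fF; have sz := flag_size fF; split.
- by move=> I /freedom_indepP[].
- by apply/freedom_indepP; split=> [|i _]; rewrite ?fsub0set // fset0I cardfs0.
- move=> I J /freedom_indepP[sJ HJ] sIJ; apply/freedom_indepP.
  split=> [|i lti]; first exact: fsubset_trans sJ.
  by apply: leq_trans (HJ i lti); apply/fsubset_leq_card/fsetSI.
- move=> I J /freedom_indepP[sI HI] /freedom_indepP[sJ HJ] ltIJ.
  pose tight (i : 'I_(size F)) := #|` I `&` nth fset0 F i| == i.
  have [x [xJ xI xT]] : exists x, [/\ x \in J, x \notin I &
      forall i, tight i -> x \notin nth fset0 F i].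
    have [[i0 ti0]|nt] := pselect (exists i, tight i); last first.
      have : ~~ (J `<=` I).
        by apply: contraL ltIJ => /fsubset_leq_card; rewrite -leqNgt.
      case/fsubsetPn => x xJ xI; exists x; split=> // i ti.
      by case: nt; exists i.
    have [i ti maxi] := arg_maxnP (fun i : 'I_(size F) => (i : nat)) ti0.
    set T := nth fset0 F i.
    have ltD : #|` I `\` T| < #|` J `\` T|.
      have := cardfsID T I; rewrite (eqP ti) => eI.
      rewrite -(ltn_add2l i) eI; apply: leq_trans ltIJ _.
      by rewrite -(cardfsID T J) leq_add2r; exact: HJ.
    have : ~~ (J `\` T `<=` I `\` T).
      by apply: contraL ltD => /fsubset_leq_card; rewrite -leqNgt.
    case/fsubsetPn => x; rewrite !inE => /andP[xT xJ]; rewrite xT /= => xI.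
    exists x; split=> // j tj; apply: contra xT.
    by apply/fsubsetP; apply: (flag_mono fF) => //; exact: maxi.
  exists x; first by rewrite !inE xI.
  apply/freedom_indepP; split=> [|i lti].
    by rewrite fsubUset fsub1set (fsubsetP sJ).
  have [ti|nti] := boolP (tight (Ordinal lti)).
    have xi := xT _ ti; suff -> : (x |` I) `&` nth fset0 F i = I `&` nth fset0 F i.
      exact: HI.
    apply/fsetP => y; rewrite !inE.
    by case: (eqVneq y x) => [->|//]; rewrite (negPf xi) !andbF.
  have lt : #|` I `&` nth fset0 F i| < i by rewrite ltn_neqAle nti HI.
  apply: leq_trans lt; rewrite -(add1n #|` _|).
  apply: leq_trans (leq_add (leqnn 1) (leqnn _)).
  rewrite -(cardfs1 x); apply: leq_trans (_ : #|` [fset x] `|` (I `&` nth fset0 F i)| <= _).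
    apply: fsubset_leq_card; apply/fsubsetP => y; rewrite !inE.
    by case/andP=> /orP[->|->] //= ->; rewrite orbT.
  by rewrite cardfsU leq_subr.
Qed.

Definition freedom_matroid S F (fF : is_flag S F) : matroid :=
  Matroid (freedom_is_matroid fF).

Definition is_freedom (M : matroid) : Prop :=
  exists S F (fF : is_flag S F), M = freedom_matroid fF.

Lemma is_freedomP M : is_freedom M <->
  exists2 F, is_flag (ground M) F & indep M = freedom_indep (ground M) F.
Proof.
split=> [[S [F [fF ->]]]|[F fF eM]]; first by exists F.
by exists (ground M), F, fF; apply: matroid_eq => // I; rewrite eM.
Qed.

(* Sublevel sets of a height function cut out the same class as flags; this   *)
(* form is visibly preserved by isomorphism, restriction and contraction.     *)
Definition below (h : nat -> nat) (I : {fset nat}) (k : nat) :=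
  [fset x in I | h x < k].

Lemma in_below h I k x : (x \in below h I k) = (x \in I) && (h x < k).
Proof. by rewrite !inE. Qed.

Definition height_form (h b : nat -> nat) (M : matroid) : Prop :=
  forall I, I `<=` ground M ->
    (I \in indep M <-> forall k, #|` below h I k| <= b k).

Lemma freedom_height M : is_freedom M -> exists h b, height_form h b M.
Proof.
case/is_freedomP => F fF eM; set S := ground M in fF eM.
have sz := flag_size fF.
pose h x := find (fun T : {fset nat} => x \in T) F.
have hP x i : i < size F -> (h x < i.+1) = (x \in nth fset0 F i).
  move=> lti; rewrite ltnS; apply/idP/idP => [le|xi].
    apply: (fsubsetP (flag_mono fF le lti)).
    apply: (@nth_find _ fset0 (fun T : {fset nat} => x \in T)).
    by rewrite has_find (leq_ltn_trans le).
  by rewrite leqNgt; apply/negP => /(before_find fset0); rewrite xi.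
have hI I i : i < size F -> below h I i.+1 = I `&` nth fset0 F i.
  by move=> lti; apply/fsetP => x; rewrite in_below hP // !inE.
exists h, predn => I sI; rewrite eM; split=> [/freedom_indepP[_ H] [|i]|H] /=.
- rewrite (_ : below h I 0 = fset0) ?cardfs0 //.
  by apply/fsetP => x; rewrite in_below ltn0 andbF inE.
- have [lti|lei] := ltnP i (size F); first by rewrite hI // H.
  have lt : (size F).-1 < size F by rewrite prednK.
  have := H _ lt; rewrite (flag_last fF) (fsetIidPl sI) => le.
  apply: leq_trans (leq_trans le _); last by rewrite -ltnS prednK // ltnW.
  by apply/fsubset_leq_card/fsubsetP => x; rewrite in_below => /andP[].
- by apply/freedom_indepP; split=> // i lti; rewrite -hI //; exact: (H i.+1).
Qed.

Lemma height_restr h b M A : A `<=` ground M ->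
  height_form h b M -> height_form h b (restr M A).
Proof.
move=> sA H I; rewrite /= (fsetIidPr sA) => sI.
by rewrite mem_restr sI andbT; apply: H; exact: fsubset_trans sA.
Qed.

Lemma height_contr h b M A : A `<=` ground M -> height_form h b M ->
  exists b', height_form h b' (contr M A).
Proof.
move=> sA H; have [B bB] := basis_exists M A; have [iB sB _] := bB.
have sBM := indep_sub iB; have HB := (H B sBM).1 iB.
exists (fun k => b k - #|` below h B k|) => I /= sI.
have sIM := fsubset_trans sI (fsubsetDl _ _).
have -> : I \in contr_indep M A = (I `|` B \in indep M).
  by rewrite (contr_indepE _ bB) sI.
have dis : [disjoint I & B].
  apply/fdisjointP => x /(fsubsetP sI); rewrite !inE => /andP[xA _].
  by apply: contra xA; exact: (fsubsetP sB).
have cU k : #|` below h (I `|` B) k| = #|` below h I k| + #|` below h B k|.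
  have -> : below h (I `|` B) k = below h I k `|` below h B k.
    by apply/fsetP => x; rewrite !(inE, in_below) andb_orl.
  rewrite cardfsU (_ : _ `&` _ = fset0) ?cardfs0 ?subn0 //.
  apply/fsetP => x; rewrite !(inE, in_below).
  apply/negP => /andP[/andP[xI _] /andP[xB _]].
  by have /fdisjointP/(_ _ xI) := dis; rewrite xB.
rewrite H; last by rewrite fsubUset sIM.
by split=> + k => /(_ k); rewrite cU leq_subRL // addnC.
Qed.

Lemma height_iso h b M N : iso M N -> height_form h b M ->
  exists h', height_form h' b N.
Proof.
rewrite iso_sym => /asboolP[g [injg eg jg]] H.
exists (h \o g) => I sI; rewrite -jg //; rewrite (H (g @` I)); last first.
  by rewrite -eg; exact: im_mono.
suff e k : #|` below h (g @` I) k| = #|` below (h \o g) I k| by split=> + k => /(_ k); rewrite e.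
have sIk : below (h \o g) I k `<=` ground N.
  by apply: fsubset_trans sI; apply/fsubsetP => x; rewrite in_below => /andP[].
rewrite -(im_card injg sIk); congr (#|` _|); apply/fsetP => y.
rewrite in_below; apply/andP/imfsetP => [[/imfsetP[x /= xI ->] hx]|[x /=]].
  by exists x; rewrite ?in_below /= ?xI.
by rewrite in_below /= => /andP[xI hx] ->; split=> //; apply/imfsetP; exists x.
Qed.

(* Flags are built by adding the elements of the ground set by increasing     *)
(* height; the length of the flag is kept equal to the rank plus one.         *)
Lemma height_freedom_rank h b M : height_form h b M ->
  exists F, [/\ is_flag (ground M) F, indep M = freedom_indep (ground M) F &
    exists2 B, B \in indep M & #|` B| = (size F).-1].
Proof.
move: {2}#|` ground M| (erefl #|` ground M|) => n.
elim: n M => [|n IHn] M cM HM.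
  have gM : ground M = fset0 by apply/eqP; rewrite -cardfs_eq0 cM.
  exists [:: fset0]; rewrite gM; split; first by rewrite /is_flag /= eqxx.
    apply/fsetP => I; apply/idP/freedom_indepP => [iI|[+ _]].
      have := indep_sub iI; rewrite gM; split=> // -[|//] _.
      by rewrite fsetI0 cardfs0.
    by rewrite fsubset0 => /eqP ->; exact: indep0.
  by exists fset0; rewrite ?indep0 ?cardfs0.
have [e eM maxe] : exists2 e, e \in ground M & forall x, x \in ground M -> h x <= h e.
  have : ground M != fset0 by rewrite -cardfs_eq0 cM.
  case/fset0Pn => e0 e0M.
  pose P (x : ground M) := true.
  have [e _ He] := arg_maxnP (P := P) (fun x => h (fsval x)) (isT : P [` e0M]).
  exists (fsval e); first exact: fsvalP.
  by move=> x xM; exact: (He [` xM] isT).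
set S := ground M in cM eM maxe *; pose T := S `\ e.
have sTS : T `<=` S by exact: fsubsetDl.
have gT : ground (restr M T) = T by rewrite /= (fsetIidPr sTS).
have [||F] := IHn (restr M T).
- by rewrite gT; apply/eqP; rewrite -eqSS -cM (cardfsD1 e S) eM.
- exact: height_restr.
rewrite gT => -[fF eF [B iB cB]].
case: (lastP F) fF eF cB => [|F0 T'] fF eF cB; first by have := flag_size fF.
have eT' : T' = T by case/and3P: fF => _ _; rewrite last_rcons => /eqP.
subst T'; rewrite size_rcons /= in cB; set r := size F0 in cB.
have iBM : B \in indep M by move: iB; rewrite mem_restr => /andP[].
have indT I : I `<=` T -> I \in indep M <->
    (forall i, i < r -> #|` I `&` nth fset0 F0 i| <= i) /\ #|` I| <= r.
  move=> sI; have -> : I \in indep M = (I \in indep (restr M T)).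
    by rewrite mem_restr sI andbT.
  rewrite eF; split=> [/freedom_indepP[_ H]|[H Hr]].
    rewrite size_rcons -/r in H; split=> [i lti|].
      by have := H i (ltnW lti); rewrite nth_rcons -/r lti.
    by have := H r (ltnSn r); rewrite nth_rcons -/r ltnn eqxx (fsetIidPl sI).
  apply/freedom_indepP; split=> // i; rewrite size_rcons -/r ltnS leq_eqVlt.
  case/orP=> [/eqP->|lti]; last by rewrite nth_rcons -/r lti H.
  by rewrite nth_rcons -/r ltnn eqxx (fsetIidPl sI).
have F0T i : i < r -> nth fset0 F0 i `<=` T.
  move=> lti; have := @flag_mono _ _ i r fF (ltnW lti).
  by rewrite size_rcons -/r !nth_rcons -/r lti ltnn eqxx; apply.
have F0I I i : i < r -> (I `\ e) `&` nth fset0 F0 i = I `&` nth fset0 F0 i.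
  move=> lti; apply/fsetP => x; rewrite !inE.
  have := fsubsetP (F0T _ lti) x; rewrite !inE.
  by case: (x \in nth _ _ _); rewrite ?andbF // => /(_ isT)/andP[-> _].
have sDe I : I `<=` S -> I `\ e `<=` T by move=> sI; exact: fsetSD.
have cI I : #|` I| <= (#|` I `\ e|).+1.
  by rewrite (cardfsD1 e I) -add1n leq_add2r leq_b1.
(* independence of I is that of I - e, together with the rank bound *)
have indM R (BR : {fset nat}) I : BR \in indep M -> #|` BR| = R -> r <= R <= r.+1 ->
    I `<=` S -> (forall i, i < r -> #|` I `&` nth fset0 F0 i| <= i) ->
    #|` I `\ e| <= r -> #|` I| <= R -> I \in indep M.
  move=> iBR cR _ sI Hi Hr HR; apply/HM => // k.
  have iD : I `\ e \in indep M.
    by apply/indT; [exact: sDe|split=> // i lti; rewrite F0I // Hi].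
  have [lek|ltk] := leqP k (h e).
    have -> : below h I k = below h (I `\ e) k.
      apply/fsetP => x; rewrite !in_below !inE.
      by case: (eqVneq x e) => [->|//]; rewrite ltnNge lek /= andbF.
    by apply: ((HM _ _).1 iD); exact: fsubset_trans (sDe _ sI) sTS.
  have below_all J : J `<=` S -> below h J k = J.
    move=> sJ; apply/fsetP => x; rewrite in_below.
    case xJ: (x \in J) => //=; apply: leq_ltn_trans ltk.
    by apply: maxe; exact: (fsubsetP sJ).
  have sBR := indep_sub iBR.
  rewrite below_all //; apply: leq_trans HR _; rewrite -cR -{1}(below_all _ sBR).
  exact: ((HM _ sBR).1 iBR).
have indM' I : I \in indep M -> [/\ I `<=` S,
    forall i, i < r -> #|` I `&` nth fset0 F0 i| <= i & #|` I `\ e| <= r].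
  move=> iI; have sI := indep_sub iI.
  have iD : I `\ e \in indep M by apply: indepS iI _; exact: fsubsetDl.
  have [H Hr] := (indT _ (sDe _ sI)).1 iD.
  by split=> // i lti; rewrite -F0I // H.
have [all_le|] := pselect (forall I, I \in indep M -> #|` I| <= r).
  exists (rcons F0 S); split.
  - case/and3P: fF => _; rewrite /is_flag last_rcons => sF _.
    rewrite last_rcons eqxx andbT; apply/andP; split; first by case: (F0).
    move: sF; case: (F0) => [|A F1] //=; rewrite !rcons_path => /andP[-> /=] lt.
    exact: fproper_sub_trans sTS.
  - apply/fsetP => I; apply/idP/freedom_indepP => [iI|[sI H]].
      have [sI H _] := indM' _ iI; split=> // i; rewrite size_rcons -/r ltnS leq_eqVlt.
      case/orP=> [/eqP->|lti]; last by rewrite nth_rcons -/r lti H.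
      by rewrite nth_rcons -/r ltnn eqxx (fsetIidPl sI) all_le.
    rewrite size_rcons -/r in H.
    have HrI : #|` I| <= r.
      by have := H r (ltnSn r); rewrite nth_rcons -/r ltnn eqxx (fsetIidPl sI).
    apply: (indM r B) => //; first by rewrite leqnn leqnSn.
      by move=> i lti; have := H i (ltnW lti); rewrite nth_rcons -/r lti.
    by apply: leq_trans HrI; apply/fsubset_leq_card/fsubsetDl.
  - by exists B; rewrite // size_rcons.
move=> nall; have [B' iB' cB'] : exists2 B', B' \in indep M & #|` B'| = r.+1.
  apply: contrapT => nB; apply: nall => I iI; rewrite leqNgt; apply/negP => lt.
  apply: nB; exists I => //; apply/eqP; rewrite eqn_leq lt andbT.
  by apply: leq_trans (cI I) _; rewrite ltnS; case: (indM' _ iI).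
exists (rcons (rcons F0 T) S); split.
- case/and3P: fF => _ sF _; rewrite /is_flag last_rcons eqxx andbT.
  apply/andP; split; first by case: (rcons F0 T).
  have ltTS : T `<` S.
    by rewrite fproperEneq sTS andbT; apply/eqP => /fsetP/(_ e); rewrite !inE eqxx eM.
  by move: sF; case: (F0) => [|A F1] /=; rewrite ?ltTS // => sF; rewrite rcons_path sF last_rcons.
- apply/fsetP => I; apply/idP/freedom_indepP => [iI|[sI]].
    have [sI H Hr] := indM' _ iI; split=> // i.
    rewrite !size_rcons -/r ltnS leq_eqVlt => /orP[/eqP->|].
      rewrite nth_rcons size_rcons -/r ltnn eqxx (fsetIidPl sI).
      by apply: leq_trans (cI I) _.
    move=> lti; rewrite nth_rcons size_rcons -/r lti nth_rcons -/r.
    move: lti; rewrite ltnS leq_eqVlt => /orP[/eqP->|lti]; last by rewrite lti H.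
    rewrite ltnn eqxx; apply: leq_trans Hr; apply/fsubset_leq_card/fsubsetP => x.
    by rewrite !inE => /and3P[-> -> _].
  rewrite !size_rcons -/r => H; apply: (indM r.+1 B') => //.
  + by rewrite leqnSn leqnn.
  + move=> i lti; have := H i (leqW (leqW lti)).
    by rewrite nth_rcons size_rcons -/r (leqW lti) nth_rcons -/r lti.
  + have := H r (ltnW (ltnSn _)); rewrite nth_rcons size_rcons -/r ltnSn nth_rcons -/r ltnn eqxx.
    apply: leq_trans; apply/fsubset_leq_card/fsubsetP => x; rewrite !inE.
    by case/andP=> -> xI; rewrite xI (fsubsetP sI).
  + by have := H r.+1 (ltnSn _); rewrite nth_rcons size_rcons -/r ltnn eqxx (fsetIidPl sI).
- by exists B'; rewrite // !size_rcons.
Qed.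

Lemma height_freedom h b M : height_form h b M -> is_freedom M.
Proof.
by move/height_freedom_rank => [F [fF eM _]]; apply/is_freedomP; exists F.
Qed.

Lemma is_freedom_iso M N : iso M N -> is_freedom M -> is_freedom N.
Proof.
move=> isoMN /freedom_height[h [b H]].
by have [h' H'] := height_iso isoMN H; exact: height_freedom H'.
Qed.

Lemma is_freedom_restr M A : A `<=` ground M -> is_freedom M -> is_freedom (restr M A).
Proof.
move=> sA /freedom_height[h [b H]].
exact: (height_freedom (height_restr sA H)).
Qed.

Lemma is_freedom_contr M A : A `<=` ground M -> is_freedom M -> is_freedom (contr M A).
Proof.
move=> sA /freedom_height[h [b H]].
by have [b' H'] := height_contr sA H; exact: height_freedom H'.
Qed.

Lemma is_freedom_null S : is_freedom (null_matroid S).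
Proof.
apply/is_freedomP; exists [:: S]; first by rewrite /is_flag /= eqxx.
apply/fsetP => I; rewrite /= inE; apply/eqP/freedom_indepP => [->|[sI /(_ 0 isT)]].
  by split=> [|i _]; rewrite ?fsub0set // fset0I cardfs0.
by rewrite /= (fsetIidPl sI) leqn0 cardfs_eq0 => /eqP.
Qed.

Lemma is_freedom_empty : is_freedom empty_matroid.
Proof. exact: is_freedom_null. Qed.

Lemma is_freedom_loop : is_freedom loop.
Proof. exact: is_freedom_null. Qed.

Lemma is_freedom_point : is_freedom point.
Proof.
apply/is_freedomP; exists [:: fset0; [fset 0]].
  by rewrite /is_flag /= eqxx !andbT fproper0; apply/fset0Pn; exists 0; rewrite inE.
apply/fsetP => I; rewrite /= fpowersetE; apply/idP/freedom_indepP => [sI|[]//].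
split=> // -[|[|//]] _ /=; first by rewrite fsetI0 cardfs0.
by rewrite (fsetIidPl sI) -(cardfs1 0) fsubset_leq_card.
Qed.

Definition freedom_class : minor_closed_class :=
  MinorClosedClass is_freedom_iso is_freedom_restr is_freedom_contr is_freedom_empty.

Local Open Scope ring_scope.

Notation freedom_algebra K := (matroid_algebra K freedom_class).

Definition point_elt (K : comNzRingType) : freedom_algebra K :=
  basis_elt K (class_in (C := freedom_class) is_freedom_point).

Definition loop_elt (K : comNzRingType) : freedom_algebra K :=
  basis_elt K (class_in (C := freedom_class) is_freedom_loop).

(* The product M_{x_1} ... M_{x_n} along a word in the letters 1 (true) and   *)
(* 0 (false).                                                                 *)
Definition word_product (K : comNzRingType) (w : seq bool) : freedom_algebra K :=
  \prod_(x <- w) (if x then point_elt K else loop_elt K).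

(* The family v, indexed by I, is a basis of V: linear combinations with      *)
(* finitely supported coefficients are unique and exhaust V.                  *)
Definition is_basis (K : comNzRingType) (V : lmodType K) (I : choiceType)
    (v : I -> V) : Prop :=
  (forall a : {malg K[I]}, \sum_(i <- msupp a) a@_i *: v i = 0 -> a = 0) /\
  (forall u : V, exists a : {malg K[I]}, u = \sum_(i <- msupp a) a@_i *: v i).

(* Main.v *)
(* The coefficient of M in M_{x_1} ... M_{x_n} counts the orderings of the     *)
(* ground set along which the rank increases exactly at the steps i with       *)
(* x_i = 1. The word of a freedom matroid is read off along increasing height, *)
(* and it determines the matroid up to isomorphism. Among the i-subsets, the   *)
(* initial segment of this ordering has least rank, so every other word        *)
(* occurring for M has at least as many ones in each prefix. The transition    *)
(* matrix from word products to freedom matroids is therefore triangular for   *)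
(* the sum of the prefix counts, with positive integers on the diagonal.       *)

Require Import Defs.
From mathcomp Require Import all_boot all_order all_algebra.
From mathcomp Require Import finmap.
From mathcomp.multinomials Require Import monalg.
From mathcomp.classical Require Import boolp.
(* all_algebra shadows basis_of. *)
Import Defs.

Set Implicit Arguments.
Unset Strict Implicit.
Unset Printing Implicit Defensive.

Local Open Scope fset_scope.
Local Open Scope nat_scope.

(** Word products and freedom matroids are both indexed by words, and the matrix between them is
    triangular. By [coef_word], the coefficient of [M] in the product along [v] is the number of
    chains of subsets of [M], growing by one element at a time, whose rank increments spell [v].

    If [M] has the word [w], its initial segments form such a chain for [w] ([count_chains_word]).
    They also have least rank among sets of their size ([word_form_rank_ge]), so any other [v] that
    occurs has larger [weight] ([count_chains_weight]). Every freedom matroid has a word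
    ([freedom_word_form]), every word has a matroid ([word_form_ex]), and the word fixes the
    isomorphism class ([word_form_iso]).

    The diagonal entries are positive integers, hence invertible in characteristic zero. A linear
    relation is refuted at its word of greatest weight; spanning follows by induction on weight. *)

(** * Rank and its behaviour under minors *)

Definition rank (M : matroid) (A : {fset nat}) : nat :=
  \max_(I <- indep M | I `<=` A) #|` I|.

Lemma rank_indep M (A I : {fset nat}) : I \in indep M -> I `<=` A -> #|` I| <= rank M A.
Proof. by move=> iI sI; apply: leq_bigmax_seq. Qed.

Lemma rank_basis M A B : basis_of M A B -> rank M A = #|` B|.
Proof.
move=> bB; have [iB sB _] := bB; apply/eqP; rewrite eqn_leq rank_indep // andbT.
by apply/bigmax_leqP_seq => I iI sI; exact: basis_max bB iI sI.
Qed.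

Lemma rankS M (A B : {fset nat}) : A `<=` B -> rank M A <= rank M B.
Proof.
move=> sAB; have [X bX] := basis_exists M A; rewrite (rank_basis bX).
by case: bX => iX sX _; apply: rank_indep => //; exact: fsubset_trans sAB.
Qed.

Lemma rank0 M : rank M fset0 = 0.
Proof.
have [X bX] := basis_exists M fset0; rewrite (rank_basis bX).
by case: bX => _; rewrite fsubset0 => /eqP ->.
Qed.

Lemma rankU1 M x (A : {fset nat}) : rank M (x |` A) <= (rank M A).+1.
Proof.
have [X bX] := basis_exists M (x |` A); rewrite (rank_basis bX).
case: bX => iX sX _; rewrite (cardfsD1 x X) -add1n leq_add ?leq_b1 //.
apply: rank_indep; first by apply: indepS iX _; exact: fsubsetDl.
by rewrite fsubDset.
Qed.

Lemma rank_restr M (A B : {fset nat}) : A `<=` B -> rank (restr M B) A = rank M A.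
Proof.
move=> sAB; have [X bX] := basis_exists M A.
by rewrite (rank_basis bX); apply/rank_basis/basis_restr.
Qed.

Lemma rank_contr M (A B : {fset nat}) : A `<=` B ->
  rank M B = rank (contr M A) (B `\` A) + rank M A.
Proof.
move=> sAB; have [X bX] := basis_exists M A.
have [Y bY] := basis_exists (contr M A) (B `\` A).
rewrite (rank_basis (basis_contr sAB bX bY)) (rank_basis bX) (rank_basis bY).
have [iX sX _] := bX; have [_ sY _] := bY.
rewrite cardfsU (_ : Y `&` X = fset0) ?cardfs0 ?subn0 //.
apply/fsetP => x; rewrite !inE; apply/negP => /andP[/(fsubsetP sY)].
by rewrite !inE => /andP[/negP xA _] /(fsubsetP sX).
Qed.

Lemma rank_iso M N : iso M N -> rank M (ground M) = rank N (ground N).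
Proof.
move=> /asboolP[f isof]; have [injf ef _] := isof.
have [X bX] := basis_exists M (ground M); have [iX _ _] := bX.
rewrite (rank_basis bX) -ef (rank_basis (is_iso_basis (fsubset_refl _) isof bX)).
by rewrite (im_card injf) ?indep_sub.
Qed.

(** * One-element matroids and chains of subsets *)

Definition letter (x : bool) : matroid := if x then point else loop.

Lemma letter_ground x : ground (letter x) = [fset 0].
Proof. by case: x. Qed.

Lemma letter_rank x : rank (letter x) (ground (letter x)) = x.
Proof.
have [X bX] := basis_exists (letter x) (ground (letter x)).
rewrite (rank_basis bX); case: x bX => -[] /=.
  move=> _ sX mX; rewrite -(mX [fset 0]) ?cardfs1 //.
  by rewrite fpowersetE.
by rewrite inE => /eqP -> _ _.
Qed.

(** On one element, independence of the singleton is the only freedom left, and the rank records it.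
    This turns the letter test in [count_chains] into arithmetic. *)
Lemma iso_letterE N x : iso N (letter x) =
  (#|` ground N| == 1) && (rank N (ground N) == x :> nat).
Proof.
apply/idP/idP => [isoN|/andP[/eqP cN /eqP rN]].
  by rewrite (card_iso isoN) (rank_iso isoN) letter_rank letter_ground cardfs1 !eqxx.
have [N' isoN gN] := iso_iota N; apply: (iso_trans isoN).
have gN' : ground N' = [fset 0].
  by apply/fsetP => y; rewrite gN !inE /= mem_iota cN ltnS leqn0.
have rN' : rank N' [fset 0] = x by rewrite -gN' -(rank_iso isoN).
suff -> : N' = letter x by exact: iso_refl.
apply: matroid_eq => [|I]; first by rewrite gN' letter_ground.
have [sI|nI] := boolP (I `<=` [fset 0]); last first.
  by apply/idP/idP => /indep_sub; rewrite ?letter_ground ?gN' => sI; rewrite sI in nI.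
move: (sI); rewrite fsubset1 => /orP[] /eqP eI; subst I; last by rewrite !indep0.
have -> : [fset 0] \in indep (letter x) = x.
  by case: (x) => /=; rewrite ?fpowersetE ?fsubset_refl // inE -cardfs_eq0 cardfs1.
apply/idP/idP => [iN|xT].
  by move: (rank_indep iN sI); rewrite rN' cardfs1; case: (x).
have [B bB] := basis_exists N' [fset 0]; have [iB sB _] := bB.
move: rN' sB; rewrite (rank_basis bB) xT fsubset1 => + /orP[] /eqP eB.
  by rewrite -eB.
by rewrite eB cardfs0.
Qed.

(* The word is taken in reverse: peeling off its last letter leads to a        *)
(* restriction, which inherits ranks from M.                                  *)
Fixpoint count_chains (rw : seq bool) (M : matroid) : nat :=
  if rw is x :: rw' then
    \sum_(X <- fpowerset (ground M))
      count_chains rw' (restr M X) * iso (contr M X) (letter x)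
  else ground M == fset0.

Definition ones (w : seq bool) (i : nat) : nat := count id (take i w).

Lemma ones_rcons w x i : i <= size w -> ones (rcons w x) i = ones w i.
Proof. by move=> le; rewrite /ones -cats1 takel_cat. Qed.

Lemma ones_size w x : ones (rcons w x) (size w).+1 = ones w (size w) + x.
Proof. by rewrite /ones -(size_rcons w x) !take_size -cats1 count_cat /= addn0. Qed.

Lemma onesS w i : i < size w -> ones w i.+1 = ones w i + nth false w i.
Proof. by move=> lt; rewrite /ones (take_nth false) // -cats1 count_cat /= addn0. Qed.

Lemma ones_min w i : ones w (minn i (size w)) = ones w i.
Proof. by rewrite /ones; case: leqP => // /ltnW le; rewrite take_size take_oversize. Qed.

Lemma restr_ground M : restr M (ground M) = M.
Proof.
apply: matroid_eq => [|I]; first by rewrite /= fsetIid.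
by rewrite mem_restr; case iI: (_ \in _) => //=; rewrite (indep_sub iI).
Qed.

Lemma count_chains_rank w M : 0 < count_chains (rev w) M ->
  size w = #|` ground M| /\
  forall i, i <= size w -> exists A,
    [/\ A `<=` ground M, #|` A| = i & rank M A = ones w i].
Proof.
elim/last_ind: w M => [|w x IHw] M.
  rewrite /= lt0b => /eqP gM; rewrite gM; split=> // i; rewrite leqn0 => /eqP ->.
  by exists fset0; rewrite fsubset_refl cardfs0 rank0.
rewrite rev_rcons /= lt0n sum_nat_seq_neq0 => /hasP[X].
rewrite /= fpowersetE muln_eq0 negb_or -lt0n eqb0 negbK => sX.
move=> /andP[/IHw[]]; rewrite /= (fsetIidPr sX) => sw IH.
rewrite iso_letterE /= => /andP[/eqP cD /eqP rD].
have cM : #|` ground M| = (size w).+1.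
  by rewrite -(cardfsID X) (fsetIidPr sX) cD sw addn1.
rewrite size_rcons; split=> // i; rewrite leq_eqVlt => /orP[/eqP ->|].
  exists (ground M); split=> //; rewrite (rank_contr _ sX) rD.
  rewrite ones_size addnC; congr (_ + _).
  (* At full size the witness can only be [X] itself, which gives the rank of [X]. *)
  have [A [sA cA rA]] := IH _ (leqnn _).
  have eA : A = X by apply/eqP; rewrite -(fsubset_leqif_cards sA) cA sw.
  by rewrite -rA eA rank_restr.
move=> lti; have [A [sA cA rA]] := IH _ lti; exists A.
by rewrite (fsubset_trans sA) // ones_rcons // -rA rank_restr.
Qed.

(** * Words of freedom matroids and prefix domination *)

(** This is [M_w] on the elements of [s] in order: of the first [k] elements, an independent set
    contains at most as many as [w] has ones among its first [k] letters. *)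
Definition word_form (w : seq bool) (s : seq nat) (M : matroid) : Prop :=
  [/\ uniq s, ground M =i s, size w = size s & height_form (index^~ s) (ones w) M].

Section WordForm.
Variables (w : seq bool) (s : seq nat) (M : matroid).
Hypothesis wM : word_form w s M.

Let init i := below (index^~ s) (ground M) i.

Lemma word_form_card : #|` ground M| = size w.
Proof.
case: wM => us gM -> _; have -> : ground M = [fset x in s] by apply/fsetP=> x; rewrite gM inE.
by rewrite card_fseq undup_id.
Qed.

Lemma init_sub i : init i `<=` ground M.
Proof. by apply/fsubsetP => x; rewrite in_below => /andP[]. Qed.

Lemma initE i : init i = [fset x in take i s].
Proof.
case: wM => us gM _ _; apply/fsetP => x; rewrite in_below inE /= gM.
have [xs|xs] := boolP (x \in s); first by rewrite in_take.
by apply/esym/negP => /mem_take; exact/negP.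
Qed.

Lemma init_card i : i <= size w -> #|` init i| = i.
Proof.
case: (wM) => us _ -> _ lei; rewrite initE card_fseq undup_id ?take_uniq //.
by rewrite size_takel.
Qed.

Lemma index_filter (p : pred nat) (t : seq nat) x :
  p x -> index x (filter p t) <= index x t.
Proof.
move=> px; elim: t => //= y t IHt; case: eqVneq => [->|ne]; first by rewrite px /= eqxx.
by case: (p y) => /=; rewrite ?(negPf ne) ?ltnS // leqW.
Qed.

(* The j-th element of A, in the order of s, has height at least j; so the     *)
(* elements of A at the positions of the ones of w form an independent set.   *)
Lemma word_form_rank_ge (A : {fset nat}) : A `<=` ground M -> ones w #|` A| <= rank M A.
Proof.
case: (wM) => us gM sw HM sA; set m := take #|` A| w.
set t := [seq x <- s | x \in A].
have mt x : x \in t = (x \in A).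
  rewrite mem_filter -gM; case xA: (x \in A) => //=.
  exact: (fsubsetP sA).
have ut : uniq t by exact: filter_uniq.
have st : size t = #|` A|.
  have <- : [fset x in t] = A by apply/fsetP => x; rewrite inE /= mt.
  by rewrite card_fseq undup_id.
have leA : #|` A| <= size w by rewrite -word_form_card fsubset_leq_card.
have sm : size m = size t by rewrite size_takel.
have stk k : size (take k m) = size (take k t) by rewrite (size_take k m) (size_take k t) sm.
pose B := [fset x in mask m t].
have sBA : B `<=` A by apply/fsubsetP => x; rewrite inE /= => /mem_mask; rewrite mt.
have <- : #|` B| = ones w #|` A| by rewrite card_fseq undup_id ?mask_uniq // size_mask.
apply: rank_indep => //; apply/HM => [|k]; first exact: fsubset_trans sA.
have sub : below (index^~ s) B k `<=` [fset x in mask (take k m) (take k t)].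
  apply/fsubsetP => x; rewrite in_below !inE /= => /andP[xm ltk].
  have xA : x \in A by rewrite -mt (mem_mask xm).
  have xt : x \in take k t.
    rewrite in_take ?mt //; apply: leq_ltn_trans ltk; exact: index_filter.
  move: xm; rewrite -{1}(cat_take_drop k m) -{1}(cat_take_drop k t) mask_cat.
    rewrite mem_cat => /orP[//|/mem_mask xd]; move: ut.
    by rewrite -(cat_take_drop k t) cat_uniq => /and3P[_ /hasPn/(_ x xd)/negP].
  exact: stk.
apply: leq_trans (fsubset_leq_card sub) _; rewrite card_fseq.
apply: leq_trans (size_undup _) _; rewrite size_mask //.
rewrite /ones /m; case: (leqP k #|` A|) => le; first by rewrite take_takel.
rewrite (take_oversize (n := k)) ?size_takel ?(ltnW le) //.
by rewrite -[X in _ <= count _ X](cat_take_drop #|` A|) take_takel ?(ltnW le) // count_cat leq_addr.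
Qed.

(** The upper bound is the defining constraint at cut-off [i], under which the whole initial segment
    lies. *)
Lemma init_rank i : i <= size w -> rank M (init i) = ones w i.
Proof.
move=> lei; apply/eqP; rewrite eqn_leq -{3}(init_card lei) word_form_rank_ge ?init_sub //.
rewrite andbT; apply/bigmax_leqP_seq => I iI sI.
case: wM => _ _ _ /(_ I (indep_sub iI))/iffLR/(_ iI i).
suff -> : below (index^~ s) I i = I by [].
apply/fsetP => x; rewrite in_below; case xI: (x \in I) => //=.
by move: (fsubsetP sI x xI); rewrite in_below => /andP[].
Qed.

Lemma count_chains_init i : i <= size w ->
  0 < count_chains (rev (take i w)) (restr M (init i)).
Proof.
elim: i => [|i IHi] lti.
  rewrite take0 /= lt0b; apply/eqP/fsetP => x.
  by rewrite inE in_below ltn0 !andbF inE.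
rewrite (take_nth false) // rev_rcons /= lt0n sum_nat_seq_neq0.
have sii : init i `<=` init i.+1.
  by apply/fsubsetP => x; rewrite !in_below => /andP[-> /= /ltnW].
rewrite (fsetIidPr (init_sub _)); apply/hasP; exists (init i); first by rewrite /= fpowersetE.
rewrite /= muln_eq0 negb_or -lt0n restr_restr // IHi 1?ltnW //= eqb0 negbK.
rewrite iso_letterE /= (fsetIidPr (init_sub _)).
have eD := cardfsID (init i) (init i.+1).
rewrite (fsetIidPr sii) !init_card // 1?ltnW // in eD.
have rD := rank_contr (restr M (init i.+1)) sii.
rewrite !rank_restr // !init_rank // 1?ltnW // onesS // addnC in rD.
by move/addIn: rD => <-; rewrite eqxx andbT -(eqn_add2l i) eD addn1.
Qed.

Lemma count_chains_word : 0 < count_chains (rev w) M.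
Proof.
have := count_chains_init (leqnn _); rewrite take_size.
suff -> : init (size w) = ground M by rewrite restr_ground.
by apply/eqP; rewrite -(fsubset_leqif_cards (init_sub _)) init_card // word_form_card.
Qed.

(** The [i]-th set of a chain for [v] has [i] elements and rank [ones v i], while every [i]-set has
    rank at least [ones w i]. *)
Lemma count_chains_dominates v : 0 < count_chains (rev v) M ->
  size v = size w /\ forall i, i <= size w -> ones w i <= ones v i.
Proof.
move/count_chains_rank; rewrite word_form_card => -[-> H]; split=> // i /H[A [sA <- <-]].
exact: word_form_rank_ge.
Qed.

End WordForm.

(** * Existence of words and uniqueness up to isomorphism *)

Lemma below_index_min (s : seq nat) (I : {fset nat}) k : {subset I <= s} ->
  below (index^~ s) I (minn k (size s)) = below (index^~ s) I k.
Proof.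
move=> sI; apply/fsetP => x; rewrite !in_below; case xI: (x \in I) => //=.
by rewrite leq_min index_mem (sI _ xI) andbT.
Qed.

(** Sending each element of [s] to the element of [t] at the same position preserves heights, hence
    all the constraints. *)
Lemma word_form_iso w s t M N : word_form w s M -> word_form w t N -> iso M N.
Proof.
move=> [us gM sw HM] [ut gN tw HN]; apply/asboolP.
pose f x := nth 0 t (index x s).
have ltf x : x \in ground M -> index x s < size t by rewrite -tw sw index_mem gM.
have idf x : x \in ground M -> index (f x) t = index x s by move=> /ltf lt; rewrite index_uniq.
have injf : {in ground M &, injective f}.
  by move=> x y xM yM /(congr1 (index^~ t)) /=; rewrite !idf // => /(index_inj 0); apply; rewrite -gM.
have ef : f @` ground M = ground N.
  apply/fsetP => y; rewrite gN; apply/imfsetP/idP => [[x /= xM ->]|yt].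
    by rewrite mem_nth ?ltf.
  have lt : index y t < size s by rewrite -sw tw index_mem.
  exists (nth 0 s (index y t)); first by rewrite /= gM mem_nth.
  by rewrite /f index_uniq // nth_index.
exists f; split=> // I sI.
have sfI : f @` I `<=` ground N by rewrite -ef; exact: im_mono.
have eb k : #|` below (index^~ t) (f @` I) k| = #|` below (index^~ s) I k|.
  have sb : below (index^~ s) I k `<=` ground M.
    by apply: fsubset_trans sI; apply/fsubsetP => x; rewrite in_below => /andP[].
  rewrite -(im_card injf sb); congr (#|` _|); apply/fsetP => y.
  rewrite in_below; apply/andP/imfsetP => /= [[/imfsetP[x /= xI ->]]|[x]].
    rewrite idf ?(fsubsetP sI) // => lt; exists x => //.
    by rewrite in_below xI.
  rewrite in_below => /andP[xI lt] ->; rewrite idf ?(fsubsetP sI) //.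
  by split=> //; apply/imfsetP; exists x.
apply/idP/idP => [/(HN _ sfI).1 H|/(HM _ sI).1 H].
  by apply/HM => // k; rewrite -eb.
by apply/HN => // k; rewrite eb.
Qed.

Definition height_indep (S : {fset nat}) (h b : nat -> nat) (n : nat) : {fset {fset nat}} :=
  [fset I in fpowerset S | [forall k : 'I_n, #|` below h I k| <= b k]].

Lemma height_indepP S h b n I :
  reflect (I `<=` S /\ forall k, k < n -> #|` below h I k| <= b k)
          (I \in height_indep S h b n).
Proof.
rewrite !inE /= fpowersetE; apply: (iffP andP) => -[sI H]; split=> //.
  by move=> k ltk; have /forallP/(_ (Ordinal ltk)) := H.
by apply/forallP => k; exact: H.
Qed.

Lemma below_cardD h (I : {fset nat}) k :
  #|` I| = #|` below h I k| + #|` I `\` below h I k|.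
Proof.
rewrite -(cardfsID (below h I k) I); congr (#|` _| + _); apply/fsetIidPr.
by apply/fsubsetP => x; rewrite in_below => /andP[].
Qed.

(** For augmentation, take the largest cut-off [k] that is tight for [I]. Outside it [J] has more
    elements than [I], so some [x] in [J] but not in [I] has height at least [k], and adding [x]
    affects no tight constraint. *)
Lemma height_is_matroid S h b n : is_matroid S (height_indep S h b n).
Proof.
have b0 k : below h fset0 k = fset0 by apply/fsetP => x; rewrite in_below !inE.
split.
- by move=> I /height_indepP[].
- by apply/height_indepP; split=> [|k _]; rewrite ?fsub0set // b0 cardfs0.
- move=> I J /height_indepP[sJ HJ] sIJ; apply/height_indepP.
  split=> [|k ltk]; first exact: fsubset_trans sJ.
  apply: leq_trans (HJ k ltk); apply/fsubset_leq_card/fsubsetP => x.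
  by rewrite !in_below => /andP[/(fsubsetP sIJ) -> ->].
move=> I J /height_indepP[sI HI] /height_indepP[sJ HJ] ltIJ.
pose tight (k : 'I_n) := #|` below h I k| == b k.
have [x [xJ xI xT]] : exists x, [/\ x \in J, x \notin I & forall k, tight k -> k <= h x].
  have [[k0 tk0]|nt] := pselect (exists k, tight k); last first.
    have : ~~ (J `<=` I) by apply: contraL ltIJ => /fsubset_leq_card; rewrite -leqNgt.
    case/fsubsetPn => x xJ xI; exists x; split=> // k tk.
    by case: nt; exists k.
  have [k tk maxk] := arg_maxnP (fun k : 'I_n => (k : nat)) tk0.
  have ltD : #|` I `\` below h I k| < #|` J `\` below h J k|.
    rewrite -(ltn_add2l (b k)) -{1}(eqP tk) -below_cardD; apply: leq_trans ltIJ _.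
    by rewrite (below_cardD h J k) leq_add2r HJ.
  have : ~~ (J `\` below h J k `<=` I `\` below h I k).
    by apply: contraL ltD => /fsubset_leq_card; rewrite -leqNgt.
  case/fsubsetPn => x; rewrite !(in_fsetD, in_below) => /andP[+ xJ].
  rewrite xJ /= -leqNgt => lekx; rewrite negb_and negbK orbC => /orP[xI|].
    by exists x; split=> // j /maxk le; exact: leq_trans le lekx.
  by rewrite ltnNge lekx andbF.
exists x; first by rewrite !inE xI.
apply/height_indepP; split=> [|k ltk]; first by rewrite fsubUset fsub1set (fsubsetP sJ).
have [lex|ltx] := leqP k (h x).
  suff -> : below h (x |` I) k = below h I k by exact: HI.
  apply/fsetP => y; rewrite !(in_below, in_fset1U).
  by case: (eqVneq y x) => [->|//]; rewrite ltnNge lex /= andbF.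
have lt : #|` below h I k| < b k.
  rewrite ltn_neqAle HI // andbT; apply: contraTN ltx => tk.
  by rewrite -leqNgt; exact: (xT (Ordinal ltk)).
apply: leq_trans lt; have -> : below h (x |` I) k = x |` below h I k.
  apply/fsetP => y; rewrite !(in_below, in_fset1U).
  by case: (eqVneq y x) => [->|//]; rewrite ltx.
by rewrite cardfsU1 -add1n leq_add2r leq_b1.
Qed.

Lemma word_form_ex w : exists s, exists2 M, word_form w s M & is_freedom M.
Proof.
pose s := iota 0 (size w).
(* The bound [(size w).+1] includes the cut-off [size w], which bounds the total rank; larger
   cut-offs repeat it. *)
pose M := Matroid (height_is_matroid [fset x in s] (index^~ s) (ones w) (size w).+1).
have gM : ground M =i s by move=> x; rewrite inE.
have sw : size w = size s by rewrite size_iota.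
have HM : height_form (index^~ s) (ones w) M.
  move=> I sI; split=> [/height_indepP[_ H] k|H].
    rewrite -below_index_min; last by move=> x /(fsubsetP sI); rewrite gM.
    by rewrite -ones_min -sw H // ltnS geq_minr.
  by apply/height_indepP; split=> // k _; exact: H.
exists s, M; last exact: height_freedom HM.
by split=> //; exact: iota_uniq.
Qed.

(* The letters of the word are the rank increments along an ordering of the    *)
(* ground set by increasing height.                                           *)
Lemma freedom_word_form M : is_freedom M -> exists w s, word_form w s M.
Proof.
case/freedom_height => h [b HM].
pose leh x y := h x <= h y.
have leh_tot : total leh by move=> x y; exact: leq_total.
have leh_tr : transitive leh by move=> y x z; exact: leq_trans.
pose s := sort leh (ground M).
have gM : ground M =i s by move=> x; rewrite mem_sort.
have us : uniq s by rewrite sort_uniq fset_uniq.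
have ss : sorted leh s by exact: sort_sorted.
pose init i := below (index^~ s) (ground M) i.
pose w := mkseq (fun i => rank M (init i) < rank M (init i.+1)) (size s).
have sw : size w = size s by rewrite size_mkseq.
have initS i : i < size s -> init i.+1 = nth 0 s i |` init i.
  move=> lti; apply/fsetP => x; rewrite in_fset1U !in_below ltnS leq_eqVlt andb_orr.
  congr (_ || _); rewrite gM; apply/andP/eqP => [[xs /eqP <-]|->]; first by rewrite nth_index.
  by rewrite mem_nth // index_uniq.
have onesE i : i <= size s -> ones w i = rank M (init i).
  elim: i => [|i IHi] lti.
    rewrite [init 0](_ : _ = fset0) ?rank0 ?/ones ?take0 //.
    by apply/fsetP => x; rewrite in_below ltn0 andbF inE.
  rewrite onesS ?sw // IHi 1?ltnW // nth_mkseq //.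
  have : rank M (init i) <= rank M (init i.+1) by rewrite initS // rankS // fsubsetU1.
  have : rank M (init i.+1) <= (rank M (init i)).+1 by rewrite initS // rankU1.
  case: ltnP => [lt le _|le _ ge]; first by rewrite addn1; apply/eqP; rewrite eqn_leq lt le.
  by rewrite addn0; apply/eqP; rewrite eqn_leq le ge.
have sb h' (I : {fset nat}) k : below h' I k `<=` I.
  by apply/fsubsetP => x; rewrite in_below => /andP[].
have bS h' (I J : {fset nat}) k : I `<=` J -> below h' I k `<=` below h' J k.
  by move=> sIJ; apply/fsubsetP => x; rewrite !in_below => /andP[/(fsubsetP sIJ) -> ->].
exists w, s; split=> // I sI; split=> [iI k|H].
  rewrite -below_index_min; last by move=> x /(fsubsetP sI); rewrite gM.
  rewrite -ones_min sw onesE ?geq_minr //; apply: rank_indep; last exact: bS.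
  exact: indepS iI (sb _ _ _).
(* As [s] is sorted by [h], the sublevel set of [h] at [k] is an initial segment of [s]; its rank is
   at most [b k], since a basis of it satisfies the constraint at [k]. *)
apply/HM => // k; pose i := find (fun x => k <= h x) s.
have hi x : x \in s -> (h x < k) = (index x s < i).
  move=> xs; apply/idP/idP => [ltk|lti].
    rewrite ltnNge; apply/negP => le.
    have hs : has (fun x => k <= h x) s by rewrite has_find (leq_ltn_trans le) ?index_mem.
    have := nth_find 0 hs; rewrite leqNgt => /negP; apply; apply: leq_ltn_trans ltk.
    rewrite -[in leqRHS](nth_index 0 xs).
    apply: (sorted_leq_nth leh_tr _ 0 ss) => //; first by move=> y; exact: leqnn.
      by rewrite inE -has_find.
    by rewrite inE index_mem.
  by rewrite ltnNge -[x in h x](nth_index 0 xs) (before_find 0 lti).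
have eb (J : {fset nat}) : J `<=` ground M -> below h J k = below (index^~ s) J i.
  move=> sJ; apply/fsetP => x; rewrite !in_below; case xJ: (x \in J) => //=.
  by rewrite hi // -gM (fsubsetP sJ).
rewrite eb //; apply: leq_trans (H i) _; rewrite onesE ?find_size //.
rewrite /init -eb //; have [B bB] := basis_exists M (below h (ground M) k).
rewrite (rank_basis bB); have [iB sB _] := bB.
apply: leq_trans ((HM _ (indep_sub iB)).1 iB k); apply/fsubset_leq_card/fsubsetP => x xB.
by move: (fsubsetP sB x xB); rewrite !in_below xB => /andP[].
Qed.

(** * A numerical measure for prefix domination *)

Definition weight (w : seq bool) : nat := \sum_(i < (size w).+1) ones w i.

Lemma ones_inj v w : size v = size w ->
  (forall i, i <= size w -> ones v i = ones w i) -> v = w.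
Proof.
move=> svw e; apply: (eq_from_nth (x0 := false) svw) => i lti.
have := e _ (ltac:(by rewrite -svw) : i < size w).
rewrite !onesS -?svw // e -?svw 1?ltnW // => /addnI.
by do 2!case: nth.
Qed.

(** Termwise domination with equal sums would make all prefix counts equal, and these determine the
    word by [ones_inj]. *)
Lemma weight_lt v w : size v = size w -> v != w ->
  (forall i, i <= size w -> ones w i <= ones v i) -> weight w < weight v.
Proof.
move=> svw ne le; rewrite /weight svw.
have := @leqif_sum _ xpredT (fun i : 'I_(size w).+1 => ones w i == ones v i)
  (fun i => ones w i) (fun i => ones v i) (fun i _ => leqif_eq (le i (ltn_ord i))).
move/ltn_leqif ->; apply: contra ne => /forall_inP e; apply/eqP/ones_inj => // i lei.
by apply/esym/eqP/(e (Ordinal (lei : i < (size w).+1))).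
Qed.

Lemma count_chains_weight w s v M : word_form w s M ->
  0 < count_chains (rev v) M -> v != w -> weight w < weight v.
Proof. by move=> wM /(count_chains_dominates wM)[svw le] ne; exact: weight_lt. Qed.

(** * Linear combinations and coefficients of word products *)

Local Open Scope ring_scope.
Import GRing.Theory.

Section LinearCombinations.
Variables (K : comNzRingType) (V : lmodType K) (I : choiceType) (v : I -> V).

Definition lincomb (a : {malg K[I]}) : V := \sum_(i <- msupp a) a@_i *: v i.

Lemma lincombE (D : {fset I}) a : msupp a `<=` D -> lincomb a = \sum_(i <- D) a@_i *: v i.
Proof.
move=> sD; apply: big_fset_incl => // i _ ia.
by rewrite mcoeff_outdom // scale0r.
Qed.

Lemma lincombU i : lincomb << 1 *g i >> = v i.
Proof. by rewrite /lincomb msuppU (negPf (oner_neq0 K)) big_seq_fset1 mcoeffUU scale1r. Qed.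

Lemma lincomb_linear : linear lincomb.
Proof.
move=> c a b; pose D := msupp (c *: a + b) `|` (msupp a `|` msupp b).
rewrite !(@lincombE D) ?fsubsetUl //; try by apply/fsubsetP => x xa; rewrite !inE xa ?orbT.
rewrite scaler_sumr -big_split /=; apply: eq_bigr => i _.
by rewrite mcoeffD mcoeffZ scalerDl scalerA.
Qed.

End LinearCombinations.

Section WordProducts.
Variable K : comNzRingType.
Local Notation P := (word_product K).

Lemma coef_at_basis (C : minor_closed_class) N (CN : C N) M : C M ->
  coef_at (basis_elt K (class_in CN)) M = (iso M N)%:R.
Proof.
move=> CM; rewrite (coef_at_in _ CM) mcoeffU -repr_inK; congr (_ *+ nat_of_bool _).
have isoM := iso_repr_in CM; have isoN := iso_repr_in CN.
rewrite iso_sym; apply/idP/idP => e.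
  by apply: iso_trans isoN; apply: iso_trans e; rewrite iso_sym.
by apply: (iso_trans isoM); apply: (iso_trans e); rewrite iso_sym.
Qed.

(** Multiplying on the right by a letter sums over restrictions whose contraction is that letter,
    which is the recursion of [count_chains]. *)
Lemma coef_word w M : is_freedom M ->
  coef_at (P w) M = (count_chains (rev w) M)%:R.
Proof.
elim/last_ind: w M => [|w x IHw] M fM.
  by rewrite /word_product big_nil coef_at_one.
rewrite rev_rcons /word_product big_rcons /= -/(P w).
rewrite (coef_at_mul (C := freedom_class)) // natr_sum; apply: eq_big_seq => X.
rewrite fpowersetE => sX; rewrite natrM IHw; last exact: is_freedom_restr.
congr (_ * _); have fc := is_freedom_contr sX fM.
by case: x; rewrite (coef_at_basis (C := freedom_class)).
Qed.

End WordProducts.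

(** * Independence and spanning by triangularity *)

Unset Implicit Arguments.

Theorem theorem8p1 (K : fieldType) (char0 : [pchar K]%R =i pred0) :
  is_basis (word_product K).
Proof.
have natr0 n : (n%:R == 0 :> K) = (n == 0%N) by move: n; apply/GRing.pcharf0P.
pose P := word_product K; split=> [a a0|u].
  apply/malgP => v0; rewrite mcoeff0; apply/eqP; rewrite mcoeff_eq0.
  apply/negP => v0a.
  pose Q (v : msupp a) := true.
  (* The relation is read at a matroid with word [w], of greatest weight in the support. Other words
     occurring there weigh more, so only the term of [w] survives. *)
  have [v _ maxv] := arg_maxnP (P := Q) (fun v => weight (fsval v)) (isT : Q [` v0a]).
  have va := fsvalP v; set w := fsval v in va maxv.
  have [s [M wM fM]] := word_form_ex w.
  have : \sum_(i <- msupp a) a@_i * (count_chains (rev i) M)%:R = 0.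
    have := congr1 (fun f : freedom_algebra K => f@_(class_in (C := freedom_class) fM)) a0.
    rewrite mcoeff0 raddf_sum /= => sum0; rewrite -[RHS]sum0; apply: eq_bigr => i _.
    by rewrite mcoeffZ -coef_at_in coef_word.
  rewrite (big_fsetD1 w) //= big1_seq ?addr0 => [/eqP|i /andP[_]].
    rewrite mulf_eq0 natr0 -[_ == 0%N]negbK -lt0n (count_chains_word wM) orbF.
    by rewrite mcoeff_eq0 va.
  rewrite !inE => /andP[ne ia]; have [->|] := posnP (count_chains (rev i) M).
    by rewrite mulr0.
  move/(count_chains_weight wM)/(_ ne); rewrite ltnNge => /negP[].
  exact: (maxv [` ia]).
pose L := lincomb P; have Llin : linear L := lincomb_linear P.
have LB a b : L (a - b) = L a - L b.
  by rewrite addrC -[- b]scaleN1r Llin scaleN1r addrC.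
have L0 : L 0 = 0 by rewrite -(subrr 0) LB subrr.
have LZ c a : L (c *: a) = c *: L a by rewrite -[c *: a]addr0 Llin L0 addr0.
pose span f := exists a, f = L a.
have span_sum (T : choiceType) (r : seq T) (F : T -> freedom_algebra K) c :
    (forall i, i \in r -> span (F i)) -> span (\sum_(i <- r) c i *: F i).
  elim: r => [|i r IHr] H; first by exists 0; rewrite big_nil L0.
  have [b eb] := IHr (fun j jr => H j (mem_behead (jr : j \in behead (i :: r)))).
  have [a ea] := H i (mem_head _ _).
  by exists (c i *: a + b); rewrite big_cons Llin -ea -eb.
have malg_sum (f : freedom_algebra K) : f = \sum_(c <- msupp f) f@_c *: basis_elt K c.
  apply/malgP => d; rewrite {1}(monalgE f) !raddf_sum /=; apply: eq_bigr => c _.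
  by rewrite mcoeffZ !mcoeffU mulrnAr mulr1.
(* Strong induction on the weight of a word of [c], with [n] as a strict bound. *)
suff span_basis n (c : iso_class_in freedom_class) w s :
    word_form w s (repr_in c) -> (weight w < n)%N -> span (basis_elt K c).
  suff [a ->] : span u by exists a.
  rewrite (malg_sum u); apply: span_sum => c _.
  have [w [s wc]] := freedom_word_form (repr_in_class c).
  exact: span_basis wc (ltnSn _).
elim: n c w s => // n IHn c w s wc; rewrite ltnS => ltn.
have coefP d : (P w)@_d = (count_chains (rev w) (repr_in d))%:R.
  by rewrite -coef_at_repr coef_word //; exact: (repr_in_class d).
have cc : (P w)@_c != 0 by rewrite coefP natr0 -lt0n (count_chains_word wc).
have cP : c \in msupp (P w) by rewrite mcoeff_neq0 in cc *.
pose rest := \sum_(d <- msupp (P w) `\ c) (P w)@_d *: basis_elt K d.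
have Pw : P w = (P w)@_c *: basis_elt K c + rest.
  by rewrite {1}(malg_sum (P w)) (big_fsetD1 c).
(* Since [w] occurs for [d], a word [v] of [d] has smaller weight unless [v = w], and that would
   make [d] equal to [c]. *)
have [b eb] : span rest.
  apply: span_sum => d; rewrite !inE => /andP[ne dP].
  have [v [t vd]] := freedom_word_form (repr_in_class d).
  apply: (IHn _ _ _ vd); apply: leq_trans ltn; apply: (count_chains_weight vd).
    by rewrite lt0n -natr0 -coefP mcoeff_neq0.
  apply: contraNneq ne => ewv; rewrite -repr_inK.
  by rewrite -ewv in vd; exact: word_form_iso vd wc.
(* [Pw] is solved for the basis element of [c]. *)
exists (((P w)@_c)^-1 *: (<< 1 *g w >> - b)).
by rewrite LZ LB -eb [L _]lincombU -/P {2}Pw addrK scalerA mulVf // scale1r.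
Qed.
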